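(* For all constants $c_0>0$ and $C>0$ there is a constant $\delta>0$ such that the following holds for all $n\ge1$. Let $a\ge c_0$ and $k_0\le 0$ be real, let $V_q(k)=a(k-k_0)^2$ for $k\in\{0,\dots,n\}$, and let $h:\{0,\dots,n\}\to\mathbb{R}_{\ge0}$ be supported on an integer interval $[\ell,u-1]\subseteq[0,n]$ with $\ell\ge1$ and satisfy $h(k)\le\bar h$ for all $k$. If $$\bar h\,\frac{u-\ell}{\sqrt{\ell}}\ \le\ C,$$ then for every $s\in[0,1]$ the Hamiltonian $$H_{qs}(s)=-(1-s)A_{hc}+s(V_q+h)$$ has spectral gap $\Delta_{qs}(s)\ge\delta$.
   Context: All matrices are real symmetric $(n+1)\times(n+1)$ matrices indexed by $\{0,\dots,n\}$. $A_{hc}$ is defined by $(A_{hc})_{k-1,k}=(A_{hc})_{k,k-1}=\sqrt{k(n+1-k)}$ for $1\le k\le n$, all other entries being $0$ (the symmetry-reduced hypercube adjacency matrix). Functions $V_q,h$ on $\{0,\dots,n\}$ are identified with diagonal matrices. The spectral gap is the difference between the two lowest eigenvalues (counted with multiplicity). *)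

(* Defs.v *)
From HB Require Import structures.
From mathcomp Require Import all_boot all_order all_algebra.
From mathcomp Require Import spectral complex.
From mathcomp Require Import boolp classical_sets reals.

Set Implicit Arguments.
Unset Strict Implicit.
Unset Printing Implicit Defensive.

Import Order.TTheory GRing.Theory Num.Theory.

Local Open Scope ring_scope.

Definition is_spectrum (R : realType) (n : nat) (A : 'M[R]_n) (e : seq R) :=
  sorted <=%R e /\ char_poly A = \prod_(x <- e) ('X - x%:P).

(* Eigenvalues in increasing order, with multiplicity; the default [::] only
   arises when the characteristic polynomial does not split over R, so never
   for a symmetric matrix (spectrumP). *)
Definition spectrum (R : realType) (n : nat) (A : 'M[R]_n) : seq R :=
  xget [::] [set e | is_spectrum A e].

(* Meaningful for symmetric matrices of size at least 2. *)
Definition spectral_gap (R : realType) (n : nat) (A : 'M[R]_n) : R :=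
  (spectrum A)`_1 - (spectrum A)`_0.

Definition diag_of (R : realType) (n : nat) (f : 'I_n -> R) : 'M[R]_n :=
  diag_mx (\row_k f k).

Definition Ahc (R : realType) (n : nat) : 'M[R]_n.+1 :=
  \matrix_(i, j)
    if j == i.+1 :> nat then Num.sqrt (j%:R * (n.+1%:R - j%:R))
    else if i == j.+1 :> nat then Num.sqrt (i%:R * (n.+1%:R - i%:R))
    else 0.

Definition Vq (R : realType) (n : nat) (a k0 : R) (k : 'I_n.+1) : R :=
  a * (k%:R - k0) ^+ 2.

Definition Hqs (R : realType) (n : nat) (a k0 : R) (h : 'I_n.+1 -> R) (s : R) :
    'M[R]_n.+1 :=
  - ((1 - s) *: Ahc R n) + s *: (diag_of (Vq a k0) + diag_of h).

Lemma sym_is_spectrum (R : realType) (n : nat) (A : 'M[R]_n) :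
  A^T = A -> exists e, is_spectrum A e.
Proof.
move=> Asym; pose Ac := map_mx (real_complex R) A.
have Ach : Ac \is hermsymmx.
  apply: realsym_hermsym.
    apply/is_hermitianmxP; rewrite expr0 scale1r map_mx_id //.
    by apply/matrixP => i j; rewrite !mxE -[in LHS]Asym mxE.
  by apply/mxOverP => i j; rewrite mxE; apply/complex_realP; exists (A i j).
have /mxOverP dreal := hermitian_spectral_diag_real Ach.
have /orthomx_spectralP Aeq := hermitian_normalmx Ach.
set P := spectralmx Ac in Aeq; set d := spectral_diag Ac in Aeq dreal.
have PU : P \in unitmx by exact: spectral_unit.
have cA : char_poly Ac = \prod_(i < n) ('X - (d 0 i)%:P).
  have -> : char_poly Ac = char_poly (diag_mx d).
    rewrite /char_poly /char_poly_mx Aeq !map_mxM /=.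
    have PV : map_mx polyC (invmx P) *m map_mx polyC P = 1%:M.
      by rewrite -map_mxM mulVmx // map_mx1.
    have -> : 'X%:M - map_mx polyC (invmx P) *m map_mx polyC (diag_mx d)
                *m map_mx polyC P =
              map_mx polyC (invmx P) *m ('X%:M - map_mx polyC (diag_mx d))
                *m map_mx polyC P.
      by rewrite mulmxBr mulmxBl mul_mx_scalar -scalemxAl PV scalemx1.
    by rewrite !det_mulmx mulrAC -det_mulmx PV det1 mul1r.
  rewrite char_poly_trig; last first.
    apply/is_trig_mxP => i j ij; rewrite mxE.
    by case: eqP ij => // ->; rewrite ltnn.
  by apply: eq_bigr => i _; rewrite mxE eqxx mulr1n.
have cAR : char_poly A = \prod_(i < n) ('X - (complex.Re (d 0 i))%:P).
  apply: (map_poly_inj (real_complex R)).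
  rewrite map_char_poly -/Ac cA rmorph_prod /=; apply: eq_bigr => i _.
  rewrite rmorphB /= map_polyX map_polyC /=.
  by have /complex_realP[x ->] := dreal 0 i.
exists (sort <=%R [seq complex.Re (d 0 i) | i <- enum 'I_n]); split.
  exact: sort_le_sorted.
rewrite cAR (perm_big [seq complex.Re (d 0 i) | i <- enum 'I_n]) /=.
  by rewrite big_map big_enum.
by rewrite perm_sort.
Qed.

Lemma spectrumP (R : realType) (n : nat) (A : 'M[R]_n) :
  A^T = A -> is_spectrum A (spectrum A).
Proof. by move=> /sym_is_spectrum; exact: (@xgetPex _ [::]). Qed.

Lemma is_spectrum_uniq (R : realType) (n : nat) (A : 'M[R]_n) (e1 e2 : seq R) :
  is_spectrum A e1 -> is_spectrum A e2 -> e1 = e2.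
Proof.
move=> [s1 p1] [s2 p2]; apply: (le_sorted_eq s1 s2).
by apply: prod_XsubC_eq; rewrite -p1 -p2.
Qed.

Lemma size_spectrum (R : realType) (n : nat) (A : 'M[R]_n) :
  A^T = A -> size (spectrum A) = n.
Proof.
move=> /spectrumP[_ /(congr1 (fun p : {poly R} => size p))].
by rewrite size_char_poly size_prod_XsubC => -[].
Qed.

Lemma Hqs_sym (R : realType) (n : nat) (a k0 : R) (h : 'I_n.+1 -> R) (s : R) :
  (Hqs a k0 h s)^T = Hqs a k0 h s.
Proof.
apply/matrixP => i j; rewrite !mxE; case: (eqVneq i j) => [->//|_].
congr (- (_ * _) + _); case: eqP => [ij|_]; case: eqP => [ji|_] //.
have ltji : (j < i)%N by rewrite ij.
have : (i < j)%N by rewrite ji.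
by rewrite ltnNge ltnW.
Qed.

(* Main.v *)
(* Let [e] be the lowest eigenvalue, [phi] the positive ground state and [K k] the
   hopping amplitude between [k.-1] and [k]. The rates
   [b k = K k.+1 * phi k.+1 / phi k] and [d k = K k * phi k.-1 / phi k] satisfy
   [b k * d k.+1 = K k.+1 ^+ 2] and [b k + d k = V k - e]. The second eigenvalue
   is at least the lowest eigenvalue of the problem with a Dirichlet condition at
   one site, here the first local maximum [m] of [phi]. To bound the latter by
   [e + delta] it is enough to find [G], positive except for [G m = 0], such that
   [d k * (G k - G k.-1) - b k * (G k.+1 - G k) >= delta * G k] for [k] past [m],
   and its mirror image for [k] before [m].

   Where the barrier vanishes, the ratios of [phi] relative to the amplitudes of
   the binomial state are monotone, because the potential is convex. So the drift
   [d k - b k] increases at least linearly and [G] can be a linear ramp. Now let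
   the barrier have area at most [C * sqrt l]. Either [phi] falls so steeply at
   its near end that the drift stays linear through it, or [K k] is of order [l] on
   a window of length of order [sqrt l] around it. In the latter case the barrier
   changes [phi] there by at most a factor [(1 + C' / sqrt l) ^+ (C'' sqrt l)],
   which is bounded, and [G] is built from a constant flux. A barrier that is low
   is a perturbation of no barrier, so only barriers of length at most
   [L * sqrt l] matter. *)

Require Import Defs.
From mathcomp Require Import all_boot all_order all_algebra.
From mathcomp Require Import reals.
From mathcomp Require Import spectral complex sequences exp ring lra zify.
Import Order.TTheory GRing.Theory Num.Theory.
Local Open Scope ring_scope.

Set Implicit Arguments.
Unset Strict Implicit.
Unset Printing Implicit Defensive.

(** The obstacle is a second hump of the ground state beyond the barrier: on its rising flank the
    drift points away from [m], and a linear ramp fails. What controls [phi] past [m] is the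
    effective potential [Q k = S k - K k - K k.+1]. It is convex, so once positive past [m] it stays
    positive and [phi] falls; where it is nonpositive, [phi] can rise only by what the barrier
    supplies.

    Uniformity in [s] has two sources: outside the barrier the drift grows by at least [2 * (1 - s)]
    per site, and when hopping is weak the slope of the potential takes over. Two regimes stand
    apart. If [K 1] is small, it cannot pay for the first increment of a ramp, but then the
    potential dominates and the Dirichlet site can be 0. At [s = 1] there is no hopping, hence no
    positive ground state.

    The sites before [m] are handled by the reflection [k -> n - k], which exchanges [b] and [d].
    The constants are chosen in order: the gap without a barrier fixes which barriers count as low,
    this fixes [L], and [L] fixes the window and its Harnack constant. *)

Ltac lia_nat := repeat match goal with H : ?T |- _ =>
    lazymatch T with
    | is_true (leq _ _) => fail
    | is_true (leq _ _ && leq _ _) => fail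
    | is_true (negb _) => fail
    | @eq nat _ _ => fail
    | _ => clear H
    end
  end; lia.

(** * Birth-death rates of a ground state *)

Lemma nat_down_ind (P : nat -> Prop) (k n : nat) :
  P n -> (forall j, (k <= j < n)%N -> P j.+1 -> P j) ->
  forall j, (k <= j <= n)%N -> P j.
Proof.
move=> Pn IH j /andP[kj jn].
have [i ji] : exists i, j = (n - i)%N by exists (n - j)%N; lia.
rewrite {j}ji in kj jn *.
elim: i kj {jn} => [|i IHi] kj; first by rewrite subn0.
have [ni|ni] := leqP n i.
  by rewrite (_ : n - i.+1 = n - i)%N; [apply: IHi; lia | lia].
apply: IH; first lia.
by rewrite (_ : (n - i.+1).+1 = n - i)%N; [apply: IHi; lia | lia].
Qed.

Lemma convex_seq_pos (R : realDomainType) (q : nat -> R) (n k : nat) :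
  (forall j, (j.+2 <= n)%N -> q j.+1 - q j <= q j.+2 - q j.+1) ->
  (k <= n)%N -> 0 < q k ->
  (forall j, (k <= j <= n)%N -> 0 < q j) \/ (forall j, (j <= k)%N -> 0 < q j).
Proof.
move=> qcvx kn qk0; have [kltn|nk] := ltnP k n; last first.
  by left => j kjn; rewrite (_ : j = k) //; lia.
have [up|down] := lerP (q k) (q k.+1).
  left; suff H i : (k + i < n)%N -> 0 < q (k + i)%N /\ q (k + i)%N <= q (k + i).+1.
    move=> j /andP[kj]; rewrite leq_eqVlt => /orP[/eqP jn|jn].
      have [i ni] : exists i, n = (k + i).+1 by exists (n.-1 - k)%N; lia.
      by rewrite jn ni; have [|? ?] := H i; [lia | lra].
    by have [|//] := H (j - k)%N; [lia | rewrite subnKC].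
  elim: i => [|i IHi]; first by rewrite addn0.
  rewrite addnS => kin; have [|p0 p1] := IHi; first lia.
  by split; [lra | have := qcvx (k + i)%N; rewrite kin => /(_ isT); lra].
right => j jk; suff H i : (i <= k)%N -> 0 < q (k - i)%N /\ q (k - i).+1 <= q (k - i)%N.
  by have [|+ _] := H (k - j)%N; [lia | rewrite subKn].
elim: i => [|i IHi] ik; first by rewrite subn0; split => //; exact: ltW.
have [|p0 p1] := IHi; first lia.
have := qcvx (k - i.+1)%N; have -> : ((k - i.+1).+1 = k - i)%N by lia.
by move=> /(_ ltac:(lia)) ?; split; lra.
Qed.

Lemma le_geometric_mean (R : realFieldType) (x y z : R) :
  0 < x -> 0 < y -> 0 <= z -> x * y = z ^+ 2 -> (x <= z) = (z <= y).
Proof.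
move=> x0 y0 z0 xy; apply/idP/idP => H.
  by rewrite leNgt; apply/negP => H2; nra.
by rewrite leNgt; apply/negP => H2; nra.
Qed.

Lemma gt_geometric_mean (R : realFieldType) (x y z : R) :
  0 < x -> 0 < y -> 0 <= z -> x * y = z ^+ 2 -> (z < x) = (y < z).
Proof. by move=> *; rewrite !ltNge (@le_geometric_mean _ x y z). Qed.

Lemma am_gm_sqrt (R : realFieldType) (x y z : R) :
  0 < x -> 0 < y -> x * y = z ^+ 2 -> 2 * z <= x + y.
Proof.
move=> x0 y0 xy; rewrite leNgt; apply/negP => H.
have : (x + y) ^+ 2 < (2 * z) ^+ 2 by rewrite ltr_sqr ?nnegrE; lra.
by have := sqr_ge0 (x - y); lra.
Qed.

Definition hop (R : realType) (n : nat) (c : R) (k : nat) : R :=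
  c * Num.sqrt (k%:R * (n.+1%:R - k%:R)).

Section Hop.
Variables (R : realType) (n : nat) (c : R).
Hypothesis c_gt0 : 0 < c.
Local Notation K := (hop n c).

Lemma hop0 : K 0 = 0. Proof. by rewrite /hop mul0r sqrtr0 mulr0. Qed.

Lemma hop_last : K n.+1 = 0.
Proof. by rewrite /hop subrr mulr0 sqrtr0 mulr0. Qed.

Lemma hop_ge0 k : 0 <= K k.
Proof. by rewrite mulr_ge0 ?sqrtr_ge0 ?ltW. Qed.

Lemma hop_gt0 k : (0 < k <= n)%N -> 0 < K k.
Proof.
move=> /andP[k0 kn]; rewrite mulr_gt0 // sqrtr_gt0 mulr_gt0 ?ltr0n //.
by rewrite subr_gt0 ltr_nat.
Qed.

Lemma hop_sqr k : (k <= n.+1)%N -> K k ^+ 2 = c ^+ 2 * (k%:R * (n.+1%:R - k%:R)).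
Proof.
by move=> kn; rewrite exprMn sqr_sqrtr // mulr_ge0 // subr_ge0 ler_nat.
Qed.

Lemma hop_rev k : (k <= n.+1)%N -> K (n.+1 - k)%N = K k.
Proof. by move=> kn; rewrite /hop natrB //; congr (_ * Num.sqrt _); ring. Qed.

(** Compared through squares: [K k ^+ 2] is a concave quadratic in [k], and
    [(x + y) ^+ 2 <= 2 * (x ^+ 2 + y ^+ 2)]. *)
Lemma hop_concave k : (k < n)%N -> K k + K k.+2 <= 2 * K k.+1.
Proof.
move=> kn; have sq : (K k + K k.+2) ^+ 2 <= (2 * K k.+1) ^+ 2.
  suff : K k ^+ 2 + K k.+2 ^+ 2 <= 2 * K k.+1 ^+ 2.
    by have := sqr_ge0 (K k - K k.+2); nra.
  rewrite !hop_sqr; try lia.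
  rewrite -!natr1; set x : R := k%:R; set y : R := n%:R.
  by have := sqr_ge0 c; nra.
by rewrite -ler_sqr // nnegrE; have := hop_ge0; [move=> h; rewrite addr_ge0 | move=> h; rewrite mulr_ge0].
Qed.

Lemma hop1_le k : (0 < k <= n)%N -> K 1 <= K k.
Proof.
move=> kn; rewrite ler_wpM2l ?(ltW c_gt0) // ler_wsqrtr // mul1r.
have [i ki] : exists i, k = i.+1 by exists k.-1; lia.
rewrite {k}ki in kn *.
have : (i%:R : R) + 1 <= n%:R by rewrite natr1 ler_nat; lia.
by rewrite -(natr1 i) -(natr1 n) ?mul1r; have := ler0n R i; nra.
Qed.

Lemma hop_mono k : (0 < k <= n)%N -> K k ^+ 2 <= K 1 ^+ 2 * k%:R.
Proof.
move=> kn; rewrite !hop_sqr; try lia.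
rewrite -[leRHS]mulrA ler_wpM2l ?sqr_ge0 //.
have [i ki] : exists i, k = i.+1 by exists k.-1; lia.
rewrite {k}ki in kn *.
have : (i%:R : R) + 1 <= n%:R by rewrite natr1 ler_nat; lia.
by rewrite -(natr1 i) -(natr1 n) ?mul1r; have := ler0n R i; nra.
Qed.

End Hop.

(* Rates of the birth-death process obtained by conjugating the Hamiltonian with
   its positive ground state: [S] is the free diagonal minus the ground energy
   and [U] is the barrier. *)
Record rates (R : realType) (n : nat) (c : R) (S U b d : nat -> R) : Prop := {
  rates_d0 : d 0 = 0;
  rates_bn : b n = 0;
  rates_b_gt0 : forall k, (k < n)%N -> 0 < b k;
  rates_d_gt0 : forall k, (k < n)%N -> 0 < d k.+1;
  rates_bd : forall k, (k < n)%N -> b k * d k.+1 = hop n c k.+1 ^+ 2;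
  rates_eq : forall k, (k <= n)%N -> b k + d k = S k + U k;
  rates_U_ge0 : forall k, 0 <= U k;
  rates_convex : forall k, (k.+2 <= n)%N -> S k.+1 - S k <= S k.+2 - S k.+1
}.

Section Rates.
Variables (R : realType) (n : nat) (c : R) (S U b d : nat -> R).
Hypothesis c_gt0 : 0 < c.
Hypothesis rt : rates n c S U b d.
Local Notation K := (hop n c).
(** The effective potential: row [k] of the Hamiltonian without barrier, minus the ground energy,
    applied to the constant vector. *)
Let Q k := S k - K k - K k.+1.

Lemma rates_b_hop k : (k < n)%N -> (b k <= K k.+1) = (K k.+1 <= d k.+1).
Proof.
move=> kn; apply: le_geometric_mean (rates_b_gt0 rt kn) (rates_d_gt0 rt kn) _ (rates_bd rt kn).
exact: hop_ge0.
Qed.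

Lemma rates_bd_ge k : (k < n)%N -> 2 * K k.+1 <= b k + d k.+1.
Proof.
by move=> kn; apply: am_gm_sqrt (rates_b_gt0 rt kn) (rates_d_gt0 rt kn) (rates_bd rt kn).
Qed.

Lemma rates_b_ge0 k : (k <= n)%N -> 0 <= b k.
Proof.
rewrite leq_eqVlt => /orP[/eqP->|kn]; first by rewrite (rates_bn rt).
exact/ltW/(rates_b_gt0 rt).
Qed.

Lemma rates_d_ge0 k : (k <= n)%N -> 0 <= d k.
Proof.
case: k => [|k] kn; first by rewrite (rates_d0 rt).
exact/ltW/(rates_d_gt0 rt).
Qed.

(** Maximum principle started at the right end: [b n = 0] gives the claim at [n], and
    [K j.+1 <= d j.+1], equivalently [b j <= K j.+1], carries it one site to the left. *)
Lemma hop_le_d k : (forall j, (k <= j <= n)%N -> 0 <= Q j) ->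
  forall j, (k <= j <= n)%N -> K j <= d j.
Proof.
move=> Q0 j kjn; have kn : (k <= n)%N by lia.
apply: (@nat_down_ind (fun j => K j <= d j) k n) kjn => [|{}j kjn IH].
  have := Q0 n; rewrite kn leqnn /Q hop_last => /(_ isT).
  by have := rates_eq rt (leqnn n); rewrite (rates_bn rt); have := rates_U_ge0 rt n; lra.
have := Q0 j; rewrite /Q => /(_ ltac:(lia)).
have := @rates_eq _ _ _ _ _ _ _ rt j ltac:(lia); have := rates_U_ge0 rt j.
by move: IH; rewrite -rates_b_hop; [lra | lia].
Qed.

Lemma hop_lt_b k : (forall j, (j <= k)%N -> 0 < Q j) ->
  forall j, (j <= k)%N -> (j < n)%N -> K j.+1 < b j.
Proof.
move=> Q0; elim=> [|j IH] jk jn.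
  have := Q0 0%N (leq0n _); rewrite /Q hop0; have := rates_eq rt (leq0n n).
  by rewrite (rates_d0 rt); have := rates_U_ge0 rt 0; lra.
have := Q0 j.+1 jk; rewrite /Q; have := rates_eq rt (ltnW jn).
have := rates_U_ge0 rt j.+1; have := IH (ltnW jk) (ltnW jn).
by rewrite ltNge rates_b_hop ?(ltnW jn) // -ltNge; lra.
Qed.

(** [Q] is convex, because [S] is convex and [hop] concave, so positivity at [k] spreads to one
    whole side. The left side is excluded: it would make [phi] strictly increase over the edge after
    [m]. *)
Lemma effective_potential_pos m k : (m < k <= n)%N -> b m <= K m.+1 -> 0 < Q k ->
  forall j, (k <= j <= n)%N -> 0 < Q j.
Proof.
move=> /andP[mk kn] bm Qk.
have [|//|H] := @convex_seq_pos _ Q n k _ kn Qk; last first.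
  by have := hop_lt_b H (ltnW mk) (leq_trans mk kn); lra.
move=> j jn; rewrite /Q; have := rates_convex rt jn.
have := @hop_concave R n c c_gt0 j ltac:(lia).
by have := @hop_concave R n c c_gt0 j.+1 ltac:(lia); lra.
Qed.

(** Past a maximum only the barrier can make [phi] rise. If [Q k.+1 > 0], the maximum principle
    makes [phi] fall from there on. Otherwise the excess of [b] over the amplitude passes from [k]
    to [k.+1] with a gain of at most [U k.+1], since [2 * K k.+1 <= b k + d k.+1]. *)
Lemma b_sub_hop_le m : b m <= K m.+1 ->
  forall k, (m <= k < n)%N -> b k - K k.+1 <= \sum_(m.+1 <= j < k.+1) U j.
Proof.
move=> bm; elim=> [|k IH] mkn.
  have m0 : m = 0%N by lia.
  by move: bm; rewrite m0 big_geq // subr_le0.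
have [<-|mk] := eqVneq m k.+1; first by rewrite big_geq // subr_le0.
have [mk' kn] : (m <= k)%N /\ (k.+1 < n)%N by lia.
rewrite big_nat_recr /=; last lia.
have [Q0|Q0] := ltrP 0 (Q k.+1).
  have Qr : forall j, (k.+1 <= j <= n)%N -> 0 <= Q j.
    by move=> j jk; apply/ltW/(@effective_potential_pos m k.+1) => //; lia.
  have := @hop_le_d k.+1 Qr k.+2 ltac:(lia); rewrite -rates_b_hop // => bk.
  have U0 : 0 <= \sum_(m.+1 <= j < k.+1) U j by apply: sumr_ge0 => j _; exact: rates_U_ge0 rt j.
  by have := rates_U_ge0 rt k.+1; lra.
have := IH ltac:(lia); have := @rates_bd_ge k ltac:(lia).
by have := rates_eq rt (ltnW kn); move: Q0; rewrite /Q; lra.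
Qed.

Lemma rates_deficit_le k : (k < n)%N -> Q k <= 0 ->
  d k - K k <= U k + Num.max 0 (d k.+1 - K k.+1).
Proof.
move=> kn; rewrite /Q => Q0; have := rates_eq rt (ltnW kn).
have := @rates_bd_ge k kn.
by have [|] := lerP 0 (d k.+1 - K k.+1); lra.
Qed.

(* [t0] and [t1] stand for the ratios of a free solution, relative to the
   binomial amplitudes, over the edges [k] and [k.+1]. If they increase, free
   propagation to the left only makes the increase worse, until it contradicts
   the equation at [0]. *)
Lemma no_ratio_increase k (t0 t1 : R) : (0 < k < n)%N -> 0 < t0 -> t0 < t1 ->
  c * (k%:R / t0) <= d k -> c * (k%:R / t0 + (n%:R - k%:R) * t1) = S k ->
  S k.+1 - S k + c * (t1 - t1^-1) < 0 -> False.
Proof.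
elim: k t0 t1 => // k IH t0 t1 /andP[_ kn] t0_gt0 t01 dk Sk neg.
have cvx : S k.+1 - S k <= S k.+2 - S k.+1 by apply: (rates_convex rt); lia.
have V01 : t1^-1 < t0^-1 by rewrite ltf_pV2 // posrE; lra.
have neg0 : S k.+1 - S k + c * (t0 - t0^-1) < 0.
  suff : c * (t0 - t0^-1) <= c * (t1 - t1^-1) by lra.
  by apply: ler_wpM2l; [exact: ltW | lra].
move: neg cvx => _ _.
have t0V : t0 * t0^-1 = 1 by rewrite divff // gt_eqF.
set p := t0^-1 in t0V V01 neg0 dk Sk *.
have p_gt0 : 0 < p by rewrite invr_gt0.
have kn' : (k%:R : R) + 1 <= n%:R by rewrite natr1 ler_nat; lia.
have rho_gt : c * (k%:R * p) < S k - c * (n%:R - k%:R) * t0.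
  have : 0 <= c * (n%:R - (k%:R + 1)) * (t1 - t0) by rewrite !mulr_ge0 ?(ltW c_gt0) //; lra.
  by move: Sk; rewrite -(natr1 k); lra.
have bd := rates_bd rt (ltnW kn).
rewrite hop_sqr in bd; last lia_nat.
(* [d k.+1] is at least its free value and the product [b k * d k.+1] is fixed, so [b k] is at most
   its free value. *)
have bk : b k <= c * (n%:R - k%:R) * t0.
  rewrite leNgt; apply/negP => H.
  suff : c * (n%:R - k%:R) * t0 * (c * (k.+1%:R * p)) < b k * d k.+1.
    rewrite bd -!natr1 => /lt_eqF/negP; apply; apply/eqP.
    transitivity (c ^+ 2 * (k%:R + 1) * (n%:R - k%:R) * (t0 * p)); first by ring.
    by rewrite t0V; ring.
  apply: (@lt_le_trans _ _ (b k * (c * (k.+1%:R * p)))).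
    by rewrite ltr_pM2r // !mulr_gt0.
  by apply: ler_wpM2l dk; apply: rates_b_ge0; lia_nat.
have eqk := rates_eq rt (ltnW (ltnW kn)).
case: k => [|k] in IH kn kn' dk Sk bd neg0 rho_gt bk eqk *.
  rewrite (rates_d0 rt) in eqk; rewrite mul0r mulr0 in rho_gt.
  by have := rates_U_ge0 rt 0; lra.
(* [rho] makes the free equation hold at this site with [t0] on its right edge. The induction
   hypothesis is applied to the ratio that it induces on the left edge. *)
set rho := S k.+1 - c * (n%:R - k.+1%:R) * t0 in rho_gt.
have k1_gt0 : 0 < k.+1%:R :> R by rewrite ltr0n.
have rho_gt0 : 0 < rho by apply: le_lt_trans rho_gt; rewrite !mulr_ge0 // ltW.
have invE : c * (k.+1%:R / (c * k.+1%:R / rho)) = rho.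
  by field; rewrite !gt_eqF // addrC natr1.
apply: (IH (c * k.+1%:R / rho) t0).
- by lia_nat.
- by rewrite divr_gt0 // mulr_gt0.
- rewrite ltr_pdivrMr //.
  have -> : c * k.+1%:R = t0 * (c * (k.+1%:R * p)).
    by transitivity (c * k.+1%:R * (t0 * p)); [rewrite t0V mulr1 | ring].
  by rewrite ltr_pM2l.
- by rewrite invE; have := rates_U_ge0 rt k.+1; rewrite /rho; lra.
- by rewrite mulrDr invE /rho; ring.
- exact: neg0.
Qed.

Section FreeRight.
Variables (i : nat) (D : nat -> R).
Hypothesis i_gt0 : (0 < i)%N.
Hypothesis D_gt0 : forall k, (i <= k <= n)%N -> 0 < D k.
Hypothesis D_le : forall k, (i <= k <= n)%N -> D k <= d k.
Hypothesis D_free : forall k, (i <= k <= n)%N -> K k.+1 ^+ 2 / D k.+1 + D k = S k.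

(** The ratio of the free solution over the edge from [k.-1] to [k], divided by that of the square
    roots of the binomial coefficients. It makes the rates explicit: [D k = c * k / t k] and
    [B k = c * (n - k) * t k.+1]. *)
Let t k := c * k%:R / D k.
Let B k := K k.+1 ^+ 2 / D k.+1.

Lemma free_t_gt0 k : (i <= k <= n)%N -> 0 < t k.
Proof. by move=> kn; rewrite divr_gt0 ?D_gt0 ?mulr_gt0 ?ltr0n //; lia. Qed.

Lemma free_DE k : (i <= k <= n)%N -> D k = c * (k%:R / t k).
Proof.
move=> kn; rewrite /t; field; rewrite !gt_eqF ?D_gt0 ?ltr0n //; lia.
Qed.

Lemma free_BE k : (i <= k.+1)%N -> (k <= n)%N -> B k = c * (n%:R - k%:R) * t k.+1.
Proof.
move=> ik kn; rewrite /B /t hop_sqr; last lia.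
by rewrite -[n.+1%:R]natr1 -[k.+1%:R]natr1; ring.
Qed.

(** Downward induction: if [t] increased from [j] to [j.+1] but not from [j.+1] to [j.+2],
    subtracting the free equations at [j] and [j.+1] would give the inequality refuted by
    [no_ratio_increase]. *)
Lemma free_t_le k : (i <= k < n)%N -> t k.+1 <= t k.
Proof.
move=> kin; suff H : (k < n)%N -> t k.+1 <= t k by apply: H; lia.
have {kin} : (i <= k <= n)%N by lia.
apply: (@nat_down_ind (fun k => (k < n)%N -> t k.+1 <= t k) i n) => [|j ij IH jn].
  by rewrite ltnn.
rewrite leNgt; apply/negP => tlt.
have [tj_gt0 tj1_gt0] : 0 < t j /\ 0 < t j.+1 by split; apply: free_t_gt0; lia_nat.
have [jn1 jn2] : (i <= j <= n)%N /\ (i <= j.+1 <= n)%N by lia_nat.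
have Sj : c * (j%:R / t j + (n%:R - j%:R) * t j.+1) = S j.
  by rewrite -(D_free jn1) -/(B j) free_BE ?(free_DE jn1); [ring | lia_nat | lia_nat].
have Sj1 : c * (j.+1%:R / t j.+1 + (n%:R - j.+1%:R) * t j.+2) = S j.+1.
  by rewrite -(D_free jn2) -/(B j.+1) free_BE ?(free_DE jn2); [ring | lia_nat | lia_nat].
have tmul : (n%:R - j.+1%:R) * (t j.+2 - t j.+1) <= 0.
  have [jn'|nj] := ltnP j.+1 n; last by rewrite (_ : n = j.+1) ?subrr ?mul0r //; lia_nat.
  by rewrite mulr_ge0_le0 ?subr_ge0 ?subr_le0 ?ler_nat ?IH // ltnW.
apply: (@no_ratio_increase j (t j) (t j.+1)) => //; first by lia_nat.
  by rewrite -free_DE // D_le.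
rewrite -Sj1 -Sj -(natr1 j).
have Vlt : (t j.+1)^-1 < (t j)^-1 by rewrite ltf_pV2.
have j_gt0 : 0 < (j%:R : R) by rewrite ltr0n; lia_nat.
move: tmul; rewrite -(natr1 j).
set p := (t j)^-1 in Vlt *; set q := (t j.+1)^-1 in Vlt *.
set x := t j.+1; set y := t j.+2; set z : R := j%:R; set N : R := n%:R => tmul.
rewrite (_ : _ + _ = c * (z * (q - p) + (N - (z + 1)) * (y - x))); last by ring.
rewrite pmulr_rlt0 // ltr_wnDr // pmulr_rlt0 // subr_lt0 //.
Qed.

Lemma free_B_le k : (i <= k <= n)%N -> B k <= B k.-1.
Proof.
move=> kin; have kE : k = k.-1.+1 by lia.
rewrite [in leRHS]/B -kE free_BE; [|lia|lia].
have -> : K k ^+ 2 / D k = c * (n%:R + 1 - k%:R) * t k.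
  by rewrite /t hop_sqr; [rewrite -(natr1 n); ring | lia].
have [kn|nk] := ltnP k n; last first.
  rewrite (_ : n = k) ?subrr ?mulr0 ?mul0r; last lia.
  apply: mulr_ge0; last by apply/ltW/free_t_gt0; lia.
  by apply: mulr_ge0; [exact: ltW | lra].
have h := @free_t_le k ltac:(lia); have h0 := @free_t_gt0 k ltac:(lia).
have hk : (k%:R : R) <= n%:R by rewrite ler_nat ltnW.
rewrite -!mulrA ler_wpM2l ?(ltW c_gt0) //.
by nra.
Qed.

Lemma free_D_le k : (i <= k < n)%N -> D k <= D k.+1.
Proof.
move=> kin; have := free_t_le kin; rewrite /t.
have D1 := @D_gt0 k ltac:(lia); have D2 := @D_gt0 k.+1 ltac:(lia).
rewrite ler_pdivrMr // mulrAC ler_pdivlMr // -!mulrA ler_pM2l // -(natr1 k).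
have : 0 < (k%:R : R) by rewrite ltr0n; lia_nat.
by nra.
Qed.

(** As [t] decreases, [B] falls by at least [c * t k.+1] and [D] rises by at least [c / t k.+1],
    together at least [2 * c]. Since [B + D = S], the total change is also at least
    [|S k.+1 - S k|]. *)
Lemma free_drift_le kappa : kappa <= 2 * c \/ (forall k, (k < n)%N -> kappa <= `|S k.+1 - S k|) ->
  forall k, (i <= k < n)%N -> B k.+1 - D k.+1 <= B k - D k - kappa.
Proof.
move=> hk k kin.
have k1n : (i <= k.+1 <= n)%N by lia.
have x_ge : c * t k.+1 <= B k - B k.+1.
  rewrite !free_BE; try lia.
  have [kn|nk] := ltnP k.+1 n; last first.
    rewrite (_ : n = k.+1); last by lia.
    by rewrite -(natr1 k); have := @free_t_gt0 k.+1 ltac:(lia); nra.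
  have := @free_t_le k.+1 ltac:(lia); have h0 := @free_t_gt0 k.+1 ltac:(lia).
  have : (k.+1%:R : R) <= n%:R by rewrite ler_nat ltnW.
  rewrite -(natr1 k) => le1 le2.
  have : 0 <= c * (n%:R - (k%:R + 1)) * (t k.+1 - t k.+2).
    by rewrite !mulr_ge0 ?(ltW c_gt0) // subr_ge0.
  by lra.
have y_ge : c * (t k.+1)^-1 <= D k.+1 - D k.
  rewrite !free_DE; try lia.
  have : (t k)^-1 <= (t k.+1)^-1 by rewrite lef_pV2 ?posrE ?free_t_gt0 ?free_t_le //; lia.
  set p := (t k)^-1; set q := (t k.+1)^-1 => pq.
  have : 0 <= c * k%:R * (q - p) by rewrite !mulr_ge0 ?(ltW c_gt0) // subr_ge0.
  by rewrite -(natr1 k); lra.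
have tpos := @free_t_gt0 k.+1 ltac:(lia).
have xpos : 0 < c * t k.+1 by rewrite mulr_gt0.
have ypos : 0 < c * (t k.+1)^-1 by rewrite mulr_gt0 ?invr_gt0.
case: hk => [hk|/(_ k ltac:(lia))]; last first.
  rewrite -(D_free k1n) -(@D_free k ltac:(lia)) -/(B k) -/(B k.+1).
  by rewrite ler_normr => /orP[|]; lra.
have : 2 * c <= c * t k.+1 + c * (t k.+1)^-1.
  rewrite -mulrDr mulrC ler_pM2l // -[2]mulr1.
  by apply: am_gm_sqrt => //; rewrite ?invr_gt0 // divff ?expr1n // gt_eqF.
by lra.
Qed.

End FreeRight.
End Rates.

(** * Sites outside the barrier *)

Lemma rates_rev (R : realType) (n : nat) (c : R) (S U b d : nat -> R) :
  rates n c S U b d ->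
  rates n c (fun k => S (n - k)%N) (fun k => U (n - k)%N)
    (fun k => d (n - k)%N) (fun k => b (n - k)%N).
Proof.
move=> rt; split => [||k kn|k kn|k kn|k kn|k|k kn].
- by rewrite subn0 (rates_bn rt).
- by rewrite subnn (rates_d0 rt).
- by rewrite (_ : n - k = (n - k.+1).+1)%N; [apply: (rates_d_gt0 rt)|]; lia.
- by apply: (rates_b_gt0 rt); lia.
- rewrite mulrC (_ : n - k = (n - k.+1).+1)%N; last lia.
  rewrite (rates_bd rt); last lia.
  by rewrite (_ : (n - k.+1).+1 = n.+1 - k.+1)%N ?hop_rev //; lia.
- by rewrite addrC (rates_eq rt) //; lia.
- exact: rates_U_ge0 rt _.
- have := @rates_convex _ _ _ _ _ _ _ rt (n - k.+2)%N ltac:(lia).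
  have -> : ((n - k.+2).+2 = n - k)%N by lia.
  have -> : ((n - k.+2).+1 = n - k.+1)%N by lia.
  by lra.
Qed.

Section Reflection.
Variables (R : realType) (n : nat) (c : R) (S U b d phi : nat -> R).
Local Notation K := (hop n c).

(** The absolute value in the slope condition serves this reflection, which turns a rising potential
    into a falling one. *)
Lemma reflect_slope (kappa : R) :
  kappa <= 2 * c \/ (forall k, (k < n)%N -> kappa <= `|S k.+1 - S k|) ->
  kappa <= 2 * c \/ (forall k, (k < n)%N -> kappa <= `|S (n - k.+1)%N - S (n - k)%N|).
Proof.
case=> [h|h]; [by left | right=> k kn].
by have := h (n - k.+1)%N ltac:(lia); rewrite distrC (_ : (n - k.+1).+1 = n - k)%N //; lia.
Qed.

Lemma reflect_d_phi : rates n c S U b d ->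
  (forall k, (k < n)%N -> d k.+1 * phi k.+1 = K k.+1 * phi k) ->
  forall k, (k <= n)%N -> d (n - k)%N * phi (n - k)%N = K k.+1 * phi (n - k.+1)%N.
Proof.
move=> rt d_phi k; rewrite leq_eqVlt => /orP[/eqP->|kn].
  by rewrite subnn (rates_d0 rt) hop_last !mul0r.
have := d_phi (n - k.+1)%N ltac:(lia); rewrite (_ : (n - k.+1).+1 = n - k)%N; last by lia.
by rewrite (_ : K (n - k)%N = K k.+1) // -(@hop_rev _ n c k.+1) ?subSS //; lia.
Qed.

Lemma reflect_b_phi :
  (forall k, (k <= n)%N -> b k * phi k = K k.+1 * phi k.+1) ->
  forall k, (k < n)%N -> b (n - k.+1)%N * phi (n - k.+1)%N = K k.+1 * phi (n - k)%N.
Proof.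
move=> b_phi k kn; have := b_phi (n - k.+1)%N ltac:(lia).
rewrite (_ : (n - k.+1).+1 = n - k)%N; last by lia.
by rewrite (_ : K (n - k)%N = K k.+1) // -(@hop_rev _ n c k.+1) ?subSS //; lia.
Qed.

End Reflection.

Lemma sum_barrier_le (R : realType) (U : nat -> R) (l u : nat) (hb : R) :
  (l <= u)%N -> (forall k, ~~ (l <= k < u)%N -> U k = 0) ->
  (forall k, 0 <= U k) -> (forall k, U k <= hb) ->
  forall i j, \sum_(i <= k < j) U k <= hb * (u%:R - l%:R).
Proof.
move=> lu U0 U_ge0 Uhb i j.
apply: (@le_trans _ _ (\sum_(0 <= k < j + u) U k)).
  have [ij|ji] := leqP i j; last by rewrite big_geq ?sumr_ge0 // ltnW.
  rewrite (@big_cat_nat _ _ _ i 0 (j + u)) //=; last by lia.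
  rewrite (@big_cat_nat _ _ _ j i (j + u)) ?leq_addr //=.
  by rewrite addrCA lerDl addr_ge0 ?sumr_ge0.
rewrite (@big_cat_nat _ _ _ l 0 (j + u)) //=; last by lia.
rewrite (@big_cat_nat _ _ _ u l (j + u)) ?leq_addl //=.
have -> : \sum_(0 <= k < l) U k = 0.
  by rewrite big_nat_cond big1 // => k /andP[kl _]; apply: U0; lia.
have -> : \sum_(u <= k < j + u) U k = 0.
  by rewrite big_nat_cond big1 // => k /andP[kl _]; apply: U0; lia.
rewrite add0r addr0.
rewrite -natrB // mulr_natr -sumr_const_nat; exact: ler_sum.
Qed.

Section RightOfBarrier.
Variables (R : realType) (n : nat) (c : R) (S U b d : nat -> R) (l u : nat) (kappa : R).
Hypothesis c_gt0 : 0 < c.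
Hypothesis rt : rates n c S U b d.
Hypothesis U0 : forall k, ~~ (l <= k < u)%N -> U k = 0.
Hypothesis slope : kappa <= 2 * c \/ (forall k, (k < n)%N -> kappa <= `|S k.+1 - S k|).
Local Notation K := (hop n c).

Lemma rates_bE k : (k <= n)%N -> K k.+1 ^+ 2 / d k.+1 = b k.
Proof.
rewrite leq_eqVlt => /orP[/eqP->|kn].
  by rewrite hop_last expr0n mul0r (rates_bn rt).
by rewrite -(rates_bd rt kn) mulfK // gt_eqF // (rates_d_gt0 rt).
Qed.

Let d_gt0 k : (0 < u)%N -> (u <= k <= n)%N -> 0 < d k.
Proof. by move=> u0; case: k => [|k] kn; [lia | apply: (rates_d_gt0 rt); lia]. Qed.

Let d_free k : (u <= k <= n)%N -> K k.+1 ^+ 2 / d k.+1 + d k = S k.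
Proof.
move=> kn; rewrite rates_bE; last lia.
by rewrite (rates_eq rt) ?U0 ?addr0 //; lia.
Qed.

Lemma right_b_le k : (0 < u)%N -> (u <= k <= n)%N -> b k <= b k.-1.
Proof.
move=> u0 kn; rewrite -!rates_bE; try lia.
by apply: (free_B_le c_gt0 rt u0) kn => // j jn; exact: d_gt0.
Qed.

Lemma right_d_le k : (0 < u)%N -> (u <= k < n)%N -> d k <= d k.+1.
Proof.
move=> u0 kn; apply: (free_D_le c_gt0 rt u0) kn => // j jn; exact: d_gt0.
Qed.

Lemma right_drift k : (0 < u)%N -> (u <= k < n)%N ->
  b k.+1 - d k.+1 <= b k - d k - kappa.
Proof.
move=> u0 kn; rewrite -!rates_bE; try lia.
by apply: (free_drift_le c_gt0 rt u0 _ _ _ slope) kn => // j jn; exact: d_gt0.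
Qed.

Lemma right_drift_far j k : (0 < u)%N -> (u <= j <= k)%N -> (k <= n)%N ->
  b k - d k <= b j - d j - kappa * (k%:R - j%:R).
Proof.
move=> u0 /andP[uj]; elim: k => [|k IH] jk kn.
  by rewrite (_ : j = 0%N); [lra | lia].
have [->|jk'] := eqVneq j k.+1; first by lra.
have := IH ltac:(lia) (ltnW kn); have := @right_drift k u0 ltac:(lia).
by rewrite -(natr1 k); lra.
Qed.

End RightOfBarrier.

Section LeftOfBarrier.
Variables (R : realType) (n : nat) (c : R) (S U b d : nat -> R) (l u : nat) (kappa : R).
Hypothesis c_gt0 : 0 < c.
Hypothesis rt : rates n c S U b d.
Hypothesis U0 : forall k, ~~ (l <= k < u)%N -> U k = 0.
Hypothesis slope : kappa <= 2 * c \/ (forall k, (k < n)%N -> kappa <= `|S k.+1 - S k|).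
Hypothesis ln : (l <= n)%N.
Local Notation K := (hop n c).

Let rtr := rates_rev rt.

Let U0r : (0 < l)%N -> forall k, ~~ (n.+1 - u <= k < n.+1 - l)%N -> U (n - k)%N = 0.
Proof. by move=> l0 k kn; apply: U0; lia. Qed.

Let sloper := reflect_slope slope.

Lemma left_d_le k : (k < l)%N -> d k <= d k.+1.
Proof.
move=> kl; have l0 : (0 < l)%N by lia.
have := right_b_le c_gt0 rtr (U0r l0) sloper.
move=> /(_ (n - k)%N ltac:(lia) ltac:(lia)); rewrite subKn; last lia.
by rewrite (_ : (n - (n - k).-1 = k.+1)%N) //; lia.
Qed.

Lemma left_b_le k : (k.+1 < l)%N -> b k.+1 <= b k.
Proof.
move=> kl; have l0 : (0 < l)%N by lia.
have := right_d_le c_gt0 rtr (U0r l0) sloper.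
move=> /(_ (n - k.+1)%N ltac:(lia) ltac:(lia)); rewrite subKn; last lia.
by rewrite (_ : (n - (n - k.+1).+1 = k)%N) //; lia.
Qed.

Lemma left_drift j k : (j <= k < l)%N ->
  b k - d k <= b j - d j - kappa * (k%:R - j%:R).
Proof.
move=> jkl; have l0 : (0 < l)%N by lia.
have := right_drift_far c_gt0 rtr (U0r l0) sloper.
move=> /(_ (n - k)%N (n - j)%N ltac:(lia) ltac:(lia) ltac:(lia)).
by rewrite !subKn ?natrB; [lra | lia ..].
Qed.

End LeftOfBarrier.

(* Down from [u], where it equals [x], the solution of the recursion
   [D k + K k.+1 ^+ 2 / D k.+1 = S k] that [d] satisfies where [U] vanishes;
   the argument [j] stands for the site [u - j]. *)
Fixpoint free_extension (R : realType) (n : nat) (c : R) (S : nat -> R) (u : nat) (x : R) (j : nat) : R :=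
  if j is j'.+1 then
    S (u - j)%N - hop n c (u - j') ^+ 2 / free_extension n c S u x j'
  else x.

Section Far.
Variables (R : realType) (n : nat) (c : R) (S U b d : nat -> R) (l u m : nat) (kappa T : R).
Hypothesis c_gt0 : 0 < c.
Hypothesis rt : rates n c S U b d.
Hypothesis U0 : forall k, ~~ (l <= k < u)%N -> U k = 0.
Hypothesis slope : kappa <= 2 * c \/ (forall k, (k < n)%N -> kappa <= `|S k.+1 - S k|).
Hypothesis UT : forall i j, \sum_(i <= k < j) U k <= T.
Hypothesis ml : (m < l)%N.
Hypothesis ln : (l <= n)%N.
Hypothesis lu : (l <= u)%N.
Local Notation K := (hop n c).
Hypothesis bm : b m <= K m.+1.
Hypothesis far : 2 * T < d l - K l.
Let Q k := S k - K k - K k.+1.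

Let D k := if (u <= k)%N then d k else free_extension n c S u (d u) (u - k).

Let U_ge0 k : 0 <= U k. Proof. exact: rates_U_ge0 rt k. Qed.

Let T_ge0 : 0 <= T. Proof. by have := UT 0 0; rewrite big_geq. Qed.

(** By [rates_deficit_le] the excess [d - K] starts above [2 * T] at [l] and, where [Q <= 0], loses
    at most the area of the barrier. *)
Lemma far_deficit k : (l <= k <= n)%N -> (k <= u)%N ->
  (forall j, (l <= j < k)%N -> Q j <= 0) -> T < d k - K k.
Proof.
move=> /andP[lk kn] ku Qle; suff H : d l - K l <= \sum_(l <= j < k) U j + Num.max 0 (d k - K k).
  by have := UT l k; move: H; have [|] := lerP 0 (d k - K k); move: T_ge0 far; lra.
elim: k lk kn ku Qle => [|k IH] lk kn ku Qle; first by have := ml; lia.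
have [lk'|lk'] := eqVneq l k.+1.
  by rewrite -lk' big_geq // add0r le_max lexx orbT.
have := IH ltac:(lia_nat) (ltnW kn) (ltnW ku) (fun j jk => Qle j ltac:(lia_nat)).
rewrite big_nat_recr /=; last by lia.
have := @rates_deficit_le R n c S U b d rt k kn (Qle k ltac:(lia)).
have := U_ge0 k.
by have [|] := lerP 0 (d k - K k); have [|] := lerP 0 (d k.+1 - K k.+1); lra.
Qed.

Let deficit k : (l <= k <= n)%N -> (k <= u)%N -> Q k <= 0 -> T < d k - K k.
Proof.
move=> kn ku Qk; apply: far_deficit => // j jk; rewrite leNgt; apply/negP => Qj.
have := effective_potential_pos c_gt0 rt (m := m) (k := j) ltac:(lia) bm Qj.
by move=> /(_ k ltac:(lia)); move: Qk; rewrite /Q; lra.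
Qed.

Let D_step k : (k < u)%N -> D k = S k - K k.+1 ^+ 2 / D k.+1.
Proof.
move=> ku; rewrite /D leqNgt ku /=.
rewrite (_ : (u - k = (u - k.+1).+1)%N) /=; last by lia.
rewrite (_ : (u - (u - k.+1).+1 = k)%N); last by lia.
rewrite subKn //; case: ifP => // uk.
have -> : (u - k.+1 = 0)%N by lia.
by rewrite (_ : u = k.+1) //; lia.
Qed.

Let D_pos k : (l <= k <= n)%N -> K k <= D k -> 0 < D k.
Proof. by move=> kn; apply: lt_le_trans; apply: hop_gt0 => //; lia. Qed.

(** With [B] for the quotient, [B * D k.+1 = b k * d k.+1 = K k.+1 ^+ 2]. Since [K k.+1] is below
    both [D k.+1] and [d k.+1], an error in [d] does not grow when it passes to [b]. *)
Let D_step_b k : (l <= k <= n)%N -> (k < u)%N ->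
  ((k < n)%N -> [/\ K k.+1 <= D k.+1, D k.+1 <= d k.+1 &
    d k.+1 - D k.+1 <= \sum_(k.+1 <= j < u) U j]) ->
  [/\ b k <= K k.+1 ^+ 2 / D k.+1, K k.+1 ^+ 2 / D k.+1 <= K k.+1 &
    K k.+1 ^+ 2 / D k.+1 - b k <= \sum_(k.+1 <= j < u) U j].
Proof.
move=> /andP[lk]; rewrite leq_eqVlt => /orP[/eqP-> _ _|kn ku /(_ kn)[KD Dd dD]].
  by rewrite hop_last expr0n mul0r (rates_bn rt) subrr sumr_ge0.
have K0 : 0 < K k.+1 by apply: hop_gt0.
have D0 : 0 < D k.+1 by lra.
have b0 := rates_b_gt0 rt kn; have bd := rates_bd rt kn.
have BE : K k.+1 ^+ 2 / D k.+1 * D k.+1 = K k.+1 ^+ 2 by rewrite mulfVK // gt_eqF.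
set B := _ / _ in BE *; move: (K k.+1) (D k.+1) B (d k.+1) (b k) K0 D0 b0 bd BE KD Dd dD.
move=> x D1 B d1 b1 x0 D10 b10 bd BE KD Dd dD.
have B0 : 0 < B by rewrite -(pmulr_lgt0 _ D10) BE exprn_gt0.
have Bx : B <= x by nra.
split => //; first by rewrite leNgt; apply/negP => h; nra.
by apply: le_trans dD; rewrite lerBlDr leNgt; apply/negP => h; nra.
Qed.

(** Removing the barrier site by site from the right lowers [d] by at most the area removed. [D]
    does not drop below [K]: where [Q > 0] the free equation itself prevents it, and where [Q <= 0]
    the excess [d - K] is larger than [T]. *)
Lemma free_extension_bounds k : (l <= k <= n)%N -> (k <= u)%N ->
  [/\ K k <= D k, D k <= d k & d k - D k <= \sum_(k <= j < u) U j].
Proof.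
pose P k := (k <= u)%N ->
  [/\ K k <= D k, D k <= d k & d k - D k <= \sum_(k <= j < u) U j].
have step j : (l <= j <= n)%N -> ((j < n)%N -> P j.+1) -> P j.
  move=> jn IH ju; have [uj|ju'] := leqP u j.
    rewrite /D uj subrr big_geq //; split => //.
    have [Qj|Qj] := ltrP 0 (Q j); last by have := deficit jn ju Qj; have := T_ge0; lra.
    apply: (hop_le_d c_gt0 rt (k := j)); last by lia.
    move=> i ji; apply/ltW.
    by apply: (effective_potential_pos c_gt0 rt (m := m) (k := j)) => //; lia.
  have [bB BK Bb] := D_step_b jn ju' (fun h => IH h ju').
  have := rates_eq rt (k := j) ltac:(lia_nat); have := D_step ju'; have := U_ge0 j.
  rewrite big_ltn //; set B := _ / _ in bB BK Bb * => U0j Dj eqj.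
  have dD : d j - D j <= U j + \sum_(j.+1 <= i < u) U i by lra.
  split => //; last by lra.
  have [Qj|Qj] := ltrP 0 (Q j); first by move: Qj; rewrite /Q; lra.
  by have := deficit jn ju Qj; have := UT j u; rewrite big_ltn //; lra.
move=> kn; apply: (@nat_down_ind P l n) kn => [|j jn Pj]; apply: step => //; lia.
Qed.

(** Comparison with the free solution: [b <= B], [D <= d], and [B - D] decreases linearly even
    inside the barrier. It starts at [l] from [B <= K l] and [D >= d l - T]. *)
Lemma far_drift k : (l <= k <= n)%N ->
  b k - d k <= - (d l - K l) + T - kappa * (k%:R - l%:R).
Proof.
have l0 : (0 < l)%N by exact: leq_ltn_trans ml.
have Dd j : (l <= j <= n)%N -> 0 < D j <= d j.
  move=> jn; have [ju|uj] := leqP j u.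
    by have [h1 h2 _] := free_extension_bounds jn ju; rewrite h2 (D_pos jn).
  rewrite /D ltnW // lexx andbT; case: j jn uj => // j jn uj.
  by apply: (rates_d_gt0 rt); lia.
have D0 j : (l <= j <= n)%N -> 0 < D j by move=> /Dd /andP[].
have Dle j : (l <= j <= n)%N -> D j <= d j by move=> /Dd /andP[].
have D_free j : (l <= j <= n)%N -> K j.+1 ^+ 2 / D j.+1 + D j = S j.
  move=> jn; have [ju|uj] := ltnP j u; first by rewrite (D_step ju) addrC subrK.
  rewrite /D uj leqW // (rates_bE rt); last by lia.
  by rewrite (rates_eq rt) ?U0 ?addr0 //; lia.
have bB j : (l <= j <= n)%N -> b j <= K j.+1 ^+ 2 / D j.+1.
  move=> /andP[lj]; rewrite leq_eqVlt => /orP[/eqP->|jn].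
    by rewrite hop_last expr0n mul0r (rates_bn rt).
  rewrite -(rates_bE rt (ltnW jn)) ler_wpM2l ?sqr_ge0 // lef_pV2 ?posrE; last first.
  - by apply: D0; lia.
  - by apply: (rates_d_gt0 rt).
  - by apply: Dle; lia.
have drift j : (l <= j <= n)%N -> K j.+1 ^+ 2 / D j.+1 - D j <=
    K l.+1 ^+ 2 / D l.+1 - D l - kappa * (j%:R - l%:R).
  elim: j => [|j IH] jn; first by lia.
  have [->|lj] := eqVneq l j.+1; first by lra.
  have := IH ltac:(lia).
  have := free_drift_le c_gt0 rt l0 D0 Dle D_free slope (k := j) ltac:(lia).
  by rewrite -(natr1 j); lra.
move=> kn; have := drift k kn; have := bB k kn; have := Dle k kn.
have lln : (l <= l <= n)%N by rewrite leqnn.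
have := free_B_le c_gt0 rt l0 D0 Dle D_free lln.
have [KD _ dD] := free_extension_bounds lln lu.
have : K l.-1.+1 ^+ 2 / D l.-1.+1 <= K l.
  rewrite prednK // ler_pdivrMr ?D0 // expr2 ler_wpM2l ?hop_ge0 //.
have := UT l u.
lra.
Qed.

End Far.

(** * Supersolutions on one side of a site *)

(* On the sites [a < i <= a + N] the increments [g i] are those of constant flux
   for the process with rates [b], [d], multiplied by the decreasing factor [tau];
   the decrease of [tau] pays for the term [delta * G k]. Past [a + N] the
   increments are constant and the drift pays. *)
Section Zone.
Variables (R : realType) (n : nat) (c : R) (b d phi : nat -> R) (a N : nat).
Variables (B H rho kz kappa A delta : R).
Local Notation K := (hop n c).
Hypothesis phi_gt0 : forall k, 0 < phi k.
Hypothesis b_phi : forall k, (k <= n)%N -> b k * phi k = K k.+1 * phi k.+1.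
Hypothesis d_phi : forall k, (k < n)%N -> d k.+1 * phi k.+1 = K k.+1 * phi k.
Hypothesis N_gt0 : (0 < N)%N.
Hypothesis B_ge0 : 0 <= B.
Hypothesis A_ge0 : 0 <= A.
Hypothesis B_le : B <= A * N%:R.
Hypothesis kz_gt0 : 0 < kz.
Hypothesis delta_gt0 : 0 < delta.
Hypothesis H_ge0 : 0 < H.
Hypothesis rhoH_ge1 : 1 <= rho * H ^+ 2.
Hypothesis harnack : forall i k, (a <= i <= k)%N -> (k <= n)%N -> (k <= a + N)%N ->
  phi k <= H * phi i.
Hypothesis K_ge : forall k, (a < k <= n)%N -> (k <= a + N)%N -> kz <= K k.
Hypothesis K_ratio : forall i j, (a < i <= n)%N -> (i <= a + N)%N ->
  (a < j <= n)%N -> (j <= a + N)%N -> K i <= rho * K j.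
Hypothesis drift : forall k, (a + N <= k <= n)%N -> kappa * (k%:R - a%:R) <= d k - b k.
Hypothesis delta_zone : delta * (2 * N%:R * (H ^+ 2 * (B + N%:R))) <= kz.
Hypothesis delta_drift : delta * (2 * (rho * H ^+ 2) * (A + 1)) <= kappa.

(** Conductance of the edge from [i.-1] to [i] for the reversible weights [phi k ^+ 2]:
    [phi k ^+ 2 * d k = E k] and [phi k ^+ 2 * b k = E k.+1], so increments proportional to [1 / E]
    carry a constant flux. *)
Let E i := K i * (phi i.-1 * phi i).
(** Each site of the zone gains the share [1 / (2 * N)] of the flux, yet [tau] stays between 1/2 and
    1 there. *)
Let tau (i : nat) : R := 1 - (i%:R - a.+1%:R) / (2 * N%:R).
Let g i := tau (minn i (a + N)) * (E a.+1 / E (minn i (a + N))).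

Definition zone_solution k := B + \sum_(a.+1 <= i < k.+1) g i.
Local Notation G := zone_solution.

Let N0 : 0 < (N%:R : R). Proof. by rewrite ltr0n. Qed.

Let K_gt0 k : (a < k <= n)%N -> (k <= a + N)%N -> 0 < K k.
Proof. by move=> kn kN; apply: lt_le_trans (K_ge kn kN). Qed.

Let E_gt0 i : (a < i <= n)%N -> (i <= a + N)%N -> 0 < E i.
Proof. by move=> iN ian; apply: mulr_gt0; [exact: K_gt0 | exact: mulr_gt0]. Qed.

Let tau_step i : tau i - tau i.+1 = (2 * N%:R)^-1.
Proof. by rewrite /tau -(natr1 i); field; rewrite gt_eqF. Qed.

Let tau_le1 i : (a < i)%N -> tau i <= 1.
Proof.
move=> ai; rewrite /tau gerBl divr_ge0 ?mulr_ge0 ?(ltW N0) // subr_ge0 ler_nat //.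
Qed.

Let tau_ge i : (i <= a + N)%N -> 1 / 2 + (2 * N%:R)^-1 <= tau i.
Proof.
move=> iN; have : (i%:R : R) <= a%:R + N%:R by rewrite -natrD ler_nat.
have V0 : 0 < (2 * N%:R : R)^-1 by rewrite invr_gt0 mulr_gt0.
have VE : (2 * N%:R : R)^-1 * (2 * N%:R) = 1 by rewrite mulVf // gt_eqF // mulr_gt0.
rewrite /tau -(natr1 a); set V := _^-1 in V0 VE * => iN'.
suff : (i%:R - (a%:R + 1)) * V <= (N%:R - 1) * V by lra.
by rewrite ler_wpM2r ?(ltW V0) //; lra.
Qed.

Let tau_ge_half i : (i <= a + N)%N -> 1 / 2 <= tau i.
Proof.
move=> iN; apply: le_trans (tau_ge iN); rewrite lerDl invr_ge0 mulr_ge0 // ltW //.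
Qed.

Let gE i : (i <= a + N)%N -> g i = tau i * (E a.+1 / E i).
Proof. by move=> iN; rewrite /g (minn_idPl iN). Qed.

Let gE_far i : (a + N <= i)%N -> g i = g (a + N)%N.
Proof. by move=> iN; rewrite /g (minn_idPr iN) minnn. Qed.

Let EE_gt0 i : (a < i <= n)%N -> (i <= a + N)%N -> 0 < E a.+1 / E i.
Proof. by move=> iN ian; rewrite divr_gt0 ?E_gt0 //; lia_nat. Qed.

Let g_gt0 i : (a < i <= n)%N -> 0 < g i.
Proof.
move=> ian; have [iN|Ni] := leqP i (a + N)%N.
  rewrite gE // mulr_gt0 ?EE_gt0 //; apply: lt_le_trans (tau_ge_half iN); lra.
rewrite gE_far ?(ltnW Ni) // gE // mulr_gt0 ?EE_gt0 //; try lia_nat.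
by apply: lt_le_trans (tau_ge_half (leqnn _)); lra.
Qed.

Lemma zone_solution_a : G a = B.
Proof. by rewrite /G big_geq // addr0. Qed.

Lemma zone_solutionS k : (a <= k)%N -> G k.+1 - G k = g k.+1.
Proof. by move=> ak; rewrite /G big_nat_recr //=; ring. Qed.

(** The normalisation by [E a.+1] lets the solution continue a ramp of slope 1. *)
Lemma zone_first_slope : (a < n)%N -> g a.+1 = 1.
Proof.
move=> an; rewrite gE; last lia_nat.
rewrite /tau subrr mul0r subr0 mul1r divff // gt_eqF // E_gt0 //; lia_nat.
Qed.

Lemma zone_solution_gt0 k : (a < k <= n)%N -> 0 < G k.
Proof.
move=> /andP[ak kn]; rewrite /G ltr_wpDl // big_nat_recr //= ltr_wpDl ?g_gt0 ?ak //.
by rewrite big_nat_cond sumr_ge0 // => i /andP[ik _]; apply/ltW/g_gt0; lia_nat.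
Qed.

Let sum_le k C : (a <= k <= n)%N -> B <= B * C ->
  (forall i, (a < i <= k)%N -> g i <= C) -> G k <= (B + (k%:R - a%:R)) * C.
Proof.
move=> /andP[ak kn] BC gC; rewrite /G mulrDl lerD //.
rewrite -natrB // mulr_natl -(subSS a k) -sumr_const_nat big_nat_cond [leRHS]big_nat_cond.
by apply: ler_sum => i /andP[ik _]; apply: gC; lia_nat.
Qed.

Let near_step k : (a < k <= n)%N -> (k < a + N)%N ->
  E a.+1 / phi k ^+ 2 * (2 * N%:R)^-1 <= d k * g k - b k * g k.+1.
Proof.
move=> akn kN; have kE : k = k.-1.+1 by lia_nat.
have pk := phi_gt0 k.
have dE : d k * g k = tau k * (E a.+1 / phi k ^+ 2).
  have Kk := @K_gt0 k akn ltac:(lia_nat).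
  have pk1 := phi_gt0 k.-1.
  have dp := @d_phi k.-1 ltac:(lia_nat); rewrite -kE in dp.
  rewrite gE; last lia_nat.
  rewrite (_ : d k = K k * phi k.-1 / phi k); last by rewrite -dp mulfK // gt_eqF.
  by rewrite /E; field; rewrite !gt_eqF.
rewrite dE; have V0 : 0 < (2 * N%:R : R)^-1 by rewrite invr_gt0 mulr_gt0.
have X0 : 0 < E a.+1 / phi k ^+ 2 by rewrite divr_gt0 ?exprn_gt0 ?E_gt0 //; lia_nat.
have [kn|nk] := ltnP k n; last first.
  have -> : b k = 0.
    have := @b_phi k ltac:(lia_nat); rewrite (_ : k = n); last by lia_nat.
    by rewrite hop_last mul0r => /eqP; rewrite mulf_eq0 (gt_eqF (phi_gt0 n)) orbF => /eqP.
  rewrite mul0r subr0 mulrC ler_pM2r //; apply: le_trans (tau_ge (ltnW kN)); lra.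
have -> : b k * g k.+1 = tau k.+1 * (E a.+1 / phi k ^+ 2).
  have Kk := @K_gt0 k.+1 ltac:(lia_nat) ltac:(lia_nat).
  have pk1 := phi_gt0 k.+1.
  rewrite gE; last lia_nat.
  rewrite (_ : b k = K k.+1 * phi k.+1 / phi k); last by rewrite -(@b_phi k (ltnW kn)) mulfK // gt_eqF.
  by rewrite /E /=; field; rewrite !gt_eqF.
by rewrite -mulrBl tau_step mulrC.
Qed.

Let near_le k : (a < k <= n)%N -> (k <= a + N)%N ->
  G k <= E a.+1 / phi k ^+ 2 * (H ^+ 2 * (B + N%:R) / kz).
Proof.
move=> akn kN; have pk := phi_gt0 k.
have E1 := @E_gt0 a.+1 ltac:(lia_nat) ltac:(lia_nat).
have EEle i : (a < i <= k)%N -> E a.+1 / E i <= E a.+1 / phi k ^+ 2 * (H ^+ 2 / kz).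
  move=> ik; have Ei := @E_gt0 i ltac:(lia_nat) ltac:(lia_nat).
  have key : phi k ^+ 2 * kz <= H ^+ 2 * E i.
    have p1 := @harnack i.-1 k ltac:(lia_nat) ltac:(lia_nat) kN.
    have p2 := @harnack i k ltac:(lia_nat) ltac:(lia_nat) kN.
    have Ki := @K_ge i ltac:(lia_nat) ltac:(lia_nat).
    have : phi k ^+ 2 <= H ^+ 2 * (phi i.-1 * phi i).
      by have := phi_gt0 i; have := phi_gt0 i.-1; nra.
    have := @K_gt0 i ltac:(lia_nat) ltac:(lia_nat); have := sqr_ge0 (phi k); rewrite /E; nra.
  rewrite ler_pdivrMr //.
  rewrite [leRHS](_ : _ = E a.+1 * (H ^+ 2 * E i / (phi k ^+ 2 * kz))).
    by rewrite ler_peMr ?(ltW E1) // ler_pdivlMr ?mul1r // mulr_gt0 ?exprn_gt0.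
  by field; rewrite !gt_eqF.
have X0 : 0 < E a.+1 / phi k ^+ 2 by rewrite divr_gt0 ?exprn_gt0.
set X := E a.+1 / phi k ^+ 2 in EEle X0 *.
have hz : 0 < H ^+ 2 / kz by rewrite divr_gt0 ?exprn_gt0.
apply: (@le_trans _ _ ((B + (k%:R - a%:R)) * (X * (H ^+ 2 / kz)))).
  apply: sum_le; first by lia_nat.
    have := EEle a.+1 ltac:(lia_nat); rewrite divff ?gt_eqF // => h.
    by rewrite ler_peMr.
  move=> i ik; apply: le_trans (EEle i ik); rewrite gE; last by lia_nat.
  by rewrite ger_pMl ?EE_gt0 ?tau_le1 //; lia_nat.
have kaN : (k%:R : R) - a%:R <= N%:R by rewrite lerBlDl -natrD ler_nat.
rewrite [leRHS](_ : _ = (B + N%:R) * (X * (H ^+ 2 / kz))); last by ring.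
by apply: ler_wpM2r; [apply/ltW/mulr_gt0 | rewrite lerD2l].
Qed.

(** The Harnack bound and the ratio of the amplitudes compare every increment with the last one; the
    factor 2 makes up for [tau >= 1 / 2]. The start [B <= A * N] is absorbed because
    [k - a >= N]. *)
Let far_le k : (a + N <= k <= n)%N ->
  G k <= (A + 1) * (k%:R - a%:R) * (2 * (rho * H ^+ 2) * g (a + N)%N).
Proof.
move=> /andP[Nk kn].
have E1 := @E_gt0 a.+1 ltac:(lia_nat) ltac:(lia_nat).
have EN := @E_gt0 (a + N)%N ltac:(lia_nat) (leqnn _).
have g0 := @g_gt0 (a + N)%N ltac:(lia_nat).
have EEle i : (a < i <= a + N)%N -> E a.+1 / E i <= 2 * (rho * H ^+ 2) * g (a + N)%N.
  move=> ik; have Ei := @E_gt0 i ltac:(lia_nat) ltac:(lia_nat).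
  have key : E (a + N)%N <= rho * H ^+ 2 * E i.
    have p1 := @harnack i.-1 (a + N).-1 ltac:(lia_nat) ltac:(lia_nat) ltac:(lia_nat).
    have p2 := @harnack i (a + N) ltac:(lia_nat) ltac:(lia_nat) (leqnn _).
    have Ki := @K_ratio (a + N) i ltac:(lia_nat) ltac:(lia_nat) ltac:(lia_nat) ltac:(lia_nat).
    have : phi (a + N).-1 * phi (a + N)%N <= H ^+ 2 * (phi i.-1 * phi i).
      rewrite expr2 mulrACA; apply: ler_pM => //; exact/ltW.
    have := @K_gt0 (a + N) ltac:(lia_nat) ltac:(lia_nat).
    have := @K_gt0 i ltac:(lia_nat) ltac:(lia_nat).
    move=> h1 h2 h3; rewrite /E [leRHS](_ : _ = rho * K i * (H ^+ 2 * (phi i.-1 * phi i))); last by ring.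
    by apply: ler_pM => //; [exact: ltW | exact/ltW/mulr_gt0].
  rewrite gE // ler_pdivrMr //.
  have := tau_ge_half (leqnn (a + N)); set t := tau _ => t2.
  rewrite [leRHS](_ : _ = 2 * t * (E a.+1 * (rho * H ^+ 2 * E i / E (a + N)%N))).
    have : E a.+1 <= E a.+1 * (rho * H ^+ 2 * E i / E (a + N)%N).
      by rewrite ler_peMr ?(ltW E1) // ler_pdivlMr // mul1r.
    by set Y := _ * (_ / _) => EY; have : 0 < Y; [exact: lt_le_trans EY | nra].
  by field; rewrite gt_eqF.
have rH0 : 0 < rho * H ^+ 2 by exact: lt_le_trans ltr01 rhoH_ge1.
set C := 2 * _ * _ in EEle *.
have C0 : 0 < C by apply: mulr_gt0 => //; exact: mulr_gt0.
apply: (@le_trans _ _ ((B + (k%:R - a%:R)) * C)).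
  apply: sum_le; first by lia_nat.
    have := EEle a.+1 ltac:(lia_nat); rewrite divff ?gt_eqF // => h.
    by rewrite ler_peMr.
  move=> i ik; have [iN|Ni] := leqP i (a + N)%N.
    apply: le_trans (EEle i _); last by lia_nat.
    by rewrite gE // ger_pMl ?EE_gt0 ?tau_le1 //; lia_nat.
  rewrite gE_far ?(ltnW Ni) // /C; apply: ler_peMl (ltW g0) _.
    by have := rhoH_ge1; set y := rho * _; lra.
rewrite ler_pM2r //.
have Nka : (N%:R : R) <= k%:R - a%:R by rewrite lerBrDl -natrD ler_nat.
by have := ler_wpM2l A_ge0 Nka; have := B_le; lra.
Qed.

Lemma zone_solution_step k : (a < k <= n)%N ->
  delta * G k <= d k * (G k - G k.-1) - b k * (G k.+1 - G k).
Proof.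
move=> akn; have kE : k = k.-1.+1 by lia_nat.
rewrite zone_solutionS; last by lia_nat.
rewrite {3}kE zone_solutionS -?kE; last by lia_nat.
have [Nk|kN] := leqP (a + N) k.
  rewrite (@gE_far k.+1) ?(@gE_far k) //; last by lia_nat.
  have g0 := @g_gt0 (a + N)%N ltac:(lia_nat).
  rewrite -mulrBl; apply: (@le_trans _ _ (kappa * (k%:R - a%:R) * g (a + N)%N)); last first.
    by rewrite ler_pM2r // drift //; lia_nat.
  apply: (@le_trans _ _ (delta * ((A + 1) * (k%:R - a%:R) * (2 * (rho * H ^+ 2) * g (a + N)%N)))).
    by rewrite ler_pM2l // far_le //; lia_nat.
  set x := g _ in g0 *.
  have ka : 0 <= (k%:R : R) - a%:R by rewrite subr_ge0 ler_nat; lia_nat.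
  rewrite [leLHS](_ : _ = delta * (2 * (rho * H ^+ 2) * (A + 1)) * ((k%:R - a%:R) * x)); last by ring.
  by rewrite -[leRHS]mulrA; apply: ler_wpM2r => //; apply: mulr_ge0 => //; exact: ltW.
apply: le_trans (near_step akn kN).
apply: (@le_trans _ _ (delta * (E a.+1 / phi k ^+ 2 * (H ^+ 2 * (B + N%:R) / kz)))).
  by rewrite ler_pM2l // near_le // ltnW.
have X0 : 0 < E a.+1 / phi k ^+ 2 by rewrite divr_gt0 ?exprn_gt0 ?E_gt0 //; lia_nat.
rewrite mulrCA ler_pM2l // mulrA ler_pdivrMr // ler_pdivlMl ?mulr_gt0 //.
by apply: le_trans delta_zone; rewrite le_eqVlt; apply/orP; left; apply/eqP; ring.
Qed.

End Zone.

(* Past [m], [G] is a positive supersolution of the birth-death operator minus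
   [delta], with Dirichlet condition at [m]. *)
Definition right_solution (R : realType) (n : nat) (b d : nat -> R) (delta : R) (m : nat) (G : nat -> R) :=
  [/\ G m = 0, forall k, (m < k <= n)%N -> 0 < G k &
    forall k, (m < k <= n)%N ->
      delta * G k <= d k * (G k - G k.-1) - b k * (G k.+1 - G k)].

(** The first increment is 2, the later ones 1. At [m.+1] the drift [d - b] may vanish; doubling the
    first increment leaves [2 * d - b >= d], which the hopping amplitude bounds from below. *)
Definition ramp (R : realType) (m k : nat) : R := if (k <= m)%N then 0 else (k - m).+1%:R.

Section Ramp.
Variables (R : realType) (n : nat) (b d : nat -> R) (delta : R) (m : nat).

Lemma rampE k : (m < k)%N -> ramp R m k = k%:R - m%:R + 1.
Proof. by move=> mk; rewrite /ramp leqNgt mk /= -natr1 natrB // ltnW. Qed.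

Lemma ramp_m : ramp R m m = 0.
Proof. by rewrite /ramp leqnn. Qed.

Lemma ramp_gt0 k : (m < k)%N -> 0 < ramp R m k.
Proof. by move=> mk; rewrite /ramp leqNgt mk /= ltr0n. Qed.

Lemma ramp_step k : (m < k)%N ->
  (k = m.+1 -> 2 * delta <= 2 * d k - b k) ->
  ((m.+1 < k)%N -> delta * (k%:R - m%:R + 1) <= d k - b k) ->
  delta * ramp R m k <= d k * (ramp R m k - ramp R m k.-1) - b k * (ramp R m k.+1 - ramp R m k).
Proof.
move=> mk h1 h2; have mk1 : (m < k.+1)%N by exact: ltnW.
rewrite (rampE mk) (rampE mk1) -(natr1 k).
have [km|km] := eqVneq k m.+1.
  by have := h1 km; rewrite km /= ramp_m -(natr1 m); lra.
have mk' : (m.+1 < k)%N by lia_nat.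
have mk1' : (m < k.-1)%N by move: mk'; case: (k).
rewrite (rampE mk1').
have -> : k.-1%:R = k%:R - 1 :> R by rewrite -subn1 natrB //; lia_nat.
by have := h2 mk'; lra.
Qed.

Lemma ramp_right_solution :
  ((m < n)%N -> 2 * delta <= 2 * d m.+1 - b m.+1) ->
  (forall k, (m.+1 < k <= n)%N -> delta * (k%:R - m%:R + 1) <= d k - b k) ->
  right_solution n b d delta m (ramp R m).
Proof.
move=> h1 h2; split => [|k mk|k mk]; first exact: ramp_m.
  by apply: ramp_gt0; lia_nat.
by apply: ramp_step => [|km|km]; [lia_nat | rewrite km; apply: h1; lia_nat | apply: h2; lia_nat].
Qed.

End Ramp.

Lemma geometric_growth_le (R : realFieldType) (phi : nat -> R) (x H : R) (i k N : nat) :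
  0 <= x -> (i <= k)%N -> (k - i <= N)%N -> 0 < phi i -> (1 + x) ^+ N <= H ->
  (forall j, (i <= j < k)%N -> phi j.+1 <= (1 + x) * phi j) -> phi k <= H * phi i.
Proof.
move=> x0 ik kiN phi0 xH step.
have pw : phi k <= (1 + x) ^+ (k - i) * phi i.
  elim: k ik {kiN} step => [|k IH] ik step.
    by rewrite (_ : i = 0%N) ?mul1r //; lia_nat.
  have [<-|ik'] := eqVneq i k.+1; first by rewrite subnn mul1r.
  rewrite subSn; last by lia_nat.
  rewrite exprS -mulrA; apply: le_trans (step k _) _; first by lia_nat.
  rewrite ler_wpM2l //; first by lra.
  by apply: IH => [|j jk]; [lia_nat | apply: step; lia_nat].
apply: le_trans pw _; rewrite ler_wpM2r ?(ltW phi0) //; apply: le_trans xH.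
by rewrite ler_weXn2l // lerDl.
Qed.

Section Right.
Variables (R : realType) (n : nat) (c : R) (S U b d phi : nat -> R) (l u m N : nat).
Variables (kappa kappa0 T kz rho H A delta : R).
Local Notation K := (hop n c).
Hypothesis c_gt0 : 0 < c.
Hypothesis rt : rates n c S U b d.
Hypothesis phi_gt0 : forall k, 0 < phi k.
Hypothesis b_phi : forall k, (k <= n)%N -> b k * phi k = K k.+1 * phi k.+1.
Hypothesis d_phi : forall k, (k < n)%N -> d k.+1 * phi k.+1 = K k.+1 * phi k.
Hypothesis U0 : forall k, ~~ (l <= k < u)%N -> U k = 0.
Hypothesis slope : kappa <= 2 * c \/ (forall k, (k < n)%N -> kappa <= `|S k.+1 - S k|).
Hypothesis UT : forall i j, \sum_(i <= k < j) U k <= T.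
Hypothesis lu : (l <= u)%N.
Hypothesis un : (u <= n.+1)%N.
Hypothesis u_gt0 : (0 < u)%N.
Hypothesis ln : (l <= n)%N.
Hypothesis bm : (m < n)%N -> b m <= K m.+1.
Hypothesis kappa_gt0 : 0 < kappa.
Hypothesis K_ge0 : forall k, (0 < k <= n)%N -> kappa0 <= K k.
Hypothesis delta_gt0 : 0 < delta.
Hypothesis delta_kappa : 16 * delta <= kappa.
Hypothesis delta_kappa0 : 2 * delta <= kappa0.
Hypothesis delta_T : (m.+1 < u)%N -> 3 * delta <= T.
Hypothesis N_gt0 : (0 < N)%N.
Hypothesis A_ge : (2 * kappa + 4 * T) <= kappa * A * N%:R.
Hypothesis A_ge0 : 0 <= A.
Hypothesis N_ge : kappa * (u%:R - l%:R + 1) + 2 * T <= kappa * N%:R / 2.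
Hypothesis kz_gt0 : 0 < kz.
Hypothesis H_ge : (1 + T / kz) ^+ N <= H.
Hypothesis rho_ge1 : 1 <= rho.
Hypothesis zone : (m.+1 < u)%N -> (l <= m)%N \/ d l - K l <= 2 * T ->
  forall i j, (l <= i <= u + N)%N -> (l <= j <= u + N)%N ->
  (0 < i <= n)%N -> (0 < j <= n)%N -> kz <= K i /\ K i <= rho * K j.
Hypothesis delta_zone : delta * (2 * N%:R * (H ^+ 2 * ((A + 1) * N%:R))) <= kz.
Hypothesis delta_drift : delta * (2 * (rho * H ^+ 2) * (A + 1)) <= kappa / 2.

Let T_ge0 : 0 <= T. Proof. by have := UT 0 0; rewrite big_geq. Qed.

Let hop_le_d_m : (m < n)%N -> K m.+1 <= d m.+1.
Proof. by move=> mn'; rewrite -(rates_b_hop c_gt0 rt) // bm. Qed.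

Let first_step : (m < n)%N -> b m.+1 <= d m.+1 -> 2 * delta <= 2 * d m.+1 - b m.+1.
Proof.
move=> mn' bd; have := @K_ge0 m.+1 ltac:(lia_nat); have := hop_le_d_m mn'.
by have := delta_kappa0; lra.
Qed.

Let linear_bound (k : nat) (w : R) : (m.+1 < k)%N -> kappa * (k%:R - m%:R - 1) <= w ->
  delta * (k%:R - m%:R + 1) <= w.
Proof.
move=> mk; apply: le_trans.
have : (m%:R : R) + 2 <= k%:R by rewrite -natrD ler_nat; lia_nat.
by have := delta_kappa; have := delta_gt0; nra.
Qed.

Let case_right : (u <= m.+1)%N -> right_solution n b d delta m (ramp R m).
Proof.
move=> um; have [mn'|nm] := ltnP m n; last first.
  by apply: ramp_right_solution => [|k kn]; lia_nat.
have w0 : b m.+1 <= d m.+1.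
  have := right_b_le c_gt0 rt U0 slope u_gt0 (k := m.+1) ltac:(lia_nat).
  by have := bm mn'; have := hop_le_d_m mn'; rewrite /=; lra.
apply: ramp_right_solution => [_|k kn]; first exact: first_step.
apply: linear_bound; first by lia_nat.
have := right_drift_far c_gt0 rt U0 slope u_gt0 (j := m.+1) (k := k) ltac:(lia_nat) ltac:(lia_nat).
by rewrite -(natr1 m); lra.
Qed.

Let left_w k : (m < k < l)%N -> b k - d k <= - (kappa * (k%:R - m%:R - 1)).
Proof.
move=> kl; have := left_drift c_gt0 rt U0 slope ln (j := m.+1) (k := k) ltac:(lia_nat).
have := left_b_le c_gt0 rt U0 slope ln (k := m) ltac:(lia_nat).
have := bm ltac:(lia_nat); have := hop_le_d_m ltac:(lia_nat).
by rewrite -(natr1 m); lra.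
Qed.

(** For [l > m.+1] the drift at [l.-1] is at least [kappa * (l - m - 2)], and
    [2 * K l <= b l.-1 + d l] turns half of it into an excess at [l]. Conversely, a small excess
    bounds the distance from [m] to the barrier. *)
Let deficit_ge : (m < l)%N -> kappa * (l%:R - m%:R - 2) / 2 <= d l - K l.
Proof.
move=> ml; have [ml1|ml1] := eqVneq l m.+1.
  have -> : (l%:R : R) = m%:R + 1 by rewrite ml1 -natr1.
  by have := hop_le_d_m ltac:(lia_nat); rewrite -ml1; have := kappa_gt0; lra.
have := @left_w l.-1 ltac:(lia_nat).
have := left_d_le c_gt0 rt U0 slope ln (k := l.-1) ltac:(lia_nat).
have := rates_bd_ge rt (k := l.-1) ltac:(lia_nat).
have -> : l.-1%:R = l%:R - 1 :> R by rewrite -subn1 natrB //; lia_nat.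
by rewrite prednK; [lra | lia_nat].
Qed.

Let case_far : (m < l)%N -> 2 * T < d l - K l -> (m.+1 < u)%N ->
  right_solution n b d delta m (ramp R m).
Proof.
move=> ml far mu; have mn' : (m < n)%N by lia_nat.
have fd k : (l <= k <= n)%N -> b k - d k <= - (d l - K l) / 2 - kappa * (k%:R - l%:R).
  move=> kn; have := far_drift c_gt0 rt U0 slope UT ml ln lu (bm mn') far kn.
  by move: far; lra.
have f0 : 0 < d l - K l by apply: le_lt_trans far; have := T_ge0; lra.
apply: ramp_right_solution => [_|k kn].
  apply: first_step => //; have [ml1|ml1] := eqVneq l m.+1.
    by have := fd l ltac:(lia_nat); rewrite ml1 in f0 *; lra.
  have := @left_w m.+1 ltac:(lia_nat).
  by rewrite -(natr1 m) (_ : _ - 1 = 0) ?mulr0; [lra | ring].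
have [kl|lk] := ltnP k l.
  by apply: linear_bound; [lia_nat | have := @left_w k ltac:(lia_nat); lra].
have fk := fd k ltac:(lia_nat).
have lk' : (l%:R : R) <= k%:R by rewrite ler_nat.
have [k3|k2] := leqP m.+3 k.
  have : (m%:R : R) + 3 <= k%:R by rewrite -natrD ler_nat; lia_nat.
  have := deficit_ge ml; have := delta_kappa; have := delta_gt0; have := kappa_gt0.
  move=> h1 h2 h3 h4 h5.
  (* At [k = m.+3] this uses the factor 16 of [delta_kappa] with equality. The quarter is half of
     the bound in [deficit_ge]. *)
  apply: (@le_trans _ _ (kappa / 4 * (k%:R - m%:R - 2))); first by nra.
  by nra.
(* Here the bound by distance degenerates. Half the excess at [l], larger than [T >= 3 * delta],
   pays instead. *)
have -> : k = m.+2 by lia_nat.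
rewrite (_ : k = m.+2) in fk lk'; last by lia_nat.
rewrite -(natr1 m.+1) -(natr1 m) in fk lk' *.
have := delta_T mu; have := kappa_gt0; nra.
Qed.

(** The zone starts on the last site before the barrier, so that its first edge leads into the
    barrier, or at [m] when [l <= m.+1]. *)
Let a := maxn l.-1 m.
Let B : R := if (m < a)%N then (a - m).+1%:R else 0.
Let zs := zone_solution n c phi a N B.
Let near_solution k := if (k <= a)%N then ramp R m k else zs k.

Section Near.
Hypothesis mu : (m.+1 < u)%N.
Hypothesis near : (l <= m)%N \/ d l - K l <= 2 * T.

Let mn' : (m < n)%N. Proof. lia_nat. Qed.

Let a_bounds : [/\ (m <= a)%N, (l <= a.+1)%N, (a < u)%N & (a < n)%N].
Proof. by rewrite /a; split; lia_nat. Qed.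

Let a_left : (m < a)%N -> a = l.-1.
Proof. by rewrite /a; lia_nat. Qed.

Let B_eq : ramp R m a = B.
Proof.
rewrite /B /ramp; have [ma _ _ _] := a_bounds.
by case: (ltnP m a).
Qed.

Let B_ge0 : 0 <= B. Proof. by rewrite /B; case: ifP. Qed.

Let N0 : 0 < (N%:R : R). Proof. by rewrite ltr0n. Qed.

Let B_le : B <= A * N%:R.
Proof.
rewrite /B; case: ifP => ma; last by rewrite mulr_ge0.
have al := a_left ma; have ml : (m < l)%N by lia_nat.
have fl : d l - K l <= 2 * T by case: near => // lm; lia_nat.
have := deficit_ge ml; have := A_ge.
have -> : ((a - m).+1 = l - m)%N by rewrite al; lia_nat.
rewrite natrB ?(ltnW ml) // => h1 h2.
by rewrite -(ler_pM2l kappa_gt0); lra.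
Qed.

Let zone_K i : (a < i <= n)%N -> (i <= a + N)%N -> kz <= K i.
Proof.
move=> ian iN; have [ma la au an] := a_bounds.
by have [] := zone mu near (i := i) (j := i) ltac:(lia_nat) ltac:(lia_nat) ltac:(lia_nat) ltac:(lia_nat).
Qed.

Let zone_ratio i j : (a < i <= n)%N -> (i <= a + N)%N ->
  (a < j <= n)%N -> (j <= a + N)%N -> K i <= rho * K j.
Proof.
move=> ian iN jan jN; have [ma la au an] := a_bounds.
by have [] := zone mu near (i := i) (j := j) ltac:(lia_nat) ltac:(lia_nat) ltac:(lia_nat) ltac:(lia_nat).
Qed.

Let b_le k : (m <= k < n)%N -> b k <= K k.+1 + T.
Proof.
move=> kn; have := b_sub_hop_le c_gt0 rt (bm mn') kn.
by have := UT m.+1 k.+1; lra.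
Qed.

(** In the zone [phi j.+1 / phi j = b j / K j.+1] is at most [1 + T / kz], as [b j] exceeds the
    amplitude by at most [T]. *)
Let harnack i k : (a <= i <= k)%N -> (k <= n)%N -> (k <= a + N)%N -> phi k <= H * phi i.
Proof.
move=> aik kn kN; have [ma la au an] := a_bounds.
apply: (@geometric_growth_le _ _ (T / kz) H i k N) => //; try lia_nat.
  by rewrite divr_ge0 // ltW.
move=> j jk; have bj := @b_le j ltac:(lia_nat).
have Kj := @zone_K j.+1 ltac:(lia_nat) ltac:(lia_nat).
have K0 : 0 < K j.+1 by exact: lt_le_trans Kj.
rewrite -(ler_pM2l K0) -b_phi; last by lia_nat.
rewrite mulrA ler_pM2r //; apply: le_trans bj _.
rewrite mulrDr mulr1 lerD2l mulrA ler_pdivlMr // mulrC.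
by apply: ler_wpM2r.
Qed.

(** At [u] the drift is at worst [- 2 * T]. It then grows linearly, and [N_ge] makes the zone long
    enough for half the slope, counted from [a], to survive. *)
Let near_drift k : (a + N <= k <= n)%N -> kappa / 2 * (k%:R - a%:R) <= d k - b k.
Proof.
move=> kn; have [ma la au an] := a_bounds.
have la' : (l%:R : R) <= a%:R + 1 by rewrite natr1 ler_nat.
have aNk : (a%:R : R) + N%:R <= k%:R by rewrite -natrD ler_nat; lia_nat.
have uk : (u <= k)%N.
  have : (u%:R : R) <= k%:R; last by rewrite ler_nat.
  suff : (u%:R : R) - l%:R + 1 <= N%:R by lra.
  rewrite -(ler_pM2l kappa_gt0); have := N_ge; have := T_ge0.
  have := mulr_gt0 kappa_gt0 N0; lra.
have := right_drift_far c_gt0 rt U0 slope u_gt0 (j := u) (k := k) ltac:(lia_nat) ltac:(lia_nat).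
have := right_b_le c_gt0 rt U0 slope u_gt0 (k := u) ltac:(lia_nat).
have := @b_le u.-1 ltac:(lia_nat); have := rates_bd_ge rt (k := u.-1) ltac:(lia_nat).
rewrite prednK // => h1 h2 h3 h4.
have := N_ge; have h5 : kappa * N%:R <= kappa * (k%:R - a%:R).
  by rewrite ler_pM2l //; lra.
have h6 : kappa * l%:R <= kappa * (a%:R + 1) by rewrite ler_pM2l.
lra.
Qed.

Let dz : delta * (2 * N%:R * (H ^+ 2 * (B + N%:R))) <= kz.
Proof.
apply: le_trans delta_zone; rewrite ler_pM2l // ler_pM2l ?mulr_gt0 //.
by apply: ler_wpM2l; [exact: sqr_ge0 | have := B_le; lra].
Qed.

Let H_ge1 : 1 <= H.
Proof. by apply: le_trans H_ge; rewrite exprn_ege1 // lerDl divr_ge0 // ltW. Qed.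

Let H_gt0 : 0 < H. Proof. exact: lt_le_trans ltr01 H_ge1. Qed.

Let rhoH : 1 <= rho * H ^+ 2.
Proof. by rewrite mulr_ege1 // exprn_ege1. Qed.

Let zs_a : zs a = B. Proof. exact: zone_solution_a. Qed.

Let zs_first : zs a.+1 - zs a = 1.
Proof.
have [ma la au an] := a_bounds.
rewrite zone_solutionS //.
by apply: (zone_first_slope phi_gt0 N_gt0 kz_gt0 zone_K).
Qed.

Let near_zone k : (a <= k)%N -> near_solution k = zs k.
Proof.
rewrite leq_eqVlt => /orP[/eqP<-|ak]; last by rewrite /near_solution leqNgt ak.
by rewrite /near_solution leqnn B_eq zs_a.
Qed.

Lemma near_right_solution : right_solution n b d delta m near_solution.
Proof.
have [ma la au an] := a_bounds.
split => [|k mk|k mk]; first by rewrite /near_solution ma ramp_m.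
  rewrite /near_solution; case: leqP => ak; first by apply: ramp_gt0; lia_nat.
  by apply: (zone_solution_gt0 phi_gt0 N_gt0 B_ge0 kz_gt0 zone_K); lia_nat.
have [ak|ka] := ltnP a k.
  rewrite !near_zone; try lia_nat.
  apply: (zone_solution_step phi_gt0 b_phi d_phi N_gt0 B_ge0 A_ge0 B_le kz_gt0 delta_gt0
    H_gt0 rhoH harnack zone_K zone_ratio near_drift dz delta_drift); lia_nat.
have ml : (m < l)%N by rewrite /a in ka; lia_nat.
have kl : (m < k < l)%N by rewrite /a in ka; lia_nat.
(* At [a] itself the next increment already belongs to the zone, but it is 1 as well, so the ramp
   estimate covers all sites up to [a]. *)
have slope1 : near_solution k.+1 - near_solution k = ramp R m k.+1 - ramp R m k.
  have [ka'|ka'] := ltnP k a; first by rewrite /near_solution ka ka'.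
  have -> : k = a by lia_nat.
  rewrite !near_zone; try lia_nat.
  rewrite zs_first !rampE; try lia_nat.
  by rewrite -(natr1 a); ring.
rewrite slope1 /near_solution ka (leq_trans (leq_pred k) ka).
have wk := @left_w k kl.
apply: ramp_step => [|km|km]; first by lia_nat.
  rewrite km; apply: first_step => //; move: wk; rewrite km -(natr1 m).
  by rewrite (_ : _ - 1 = 0) ?mulr0; [lra | ring].
by apply: linear_bound => //; lra.
Qed.

End Near.

Lemma right_solution_exists : exists G, right_solution n b d delta m G.
Proof.
have [um|mu] := leqP u m.+1; first by exists (ramp R m); exact: case_right.
have [lm|ml] := leqP l m; first by exists near_solution; apply: near_right_solution => //; left.
have [near|far] := lerP (d l - K l) (2 * T).
  by exists near_solution; apply: near_right_solution => //; right.
by exists (ramp R m); exact: case_far.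
Qed.

End Right.

(** * Spectra of real symmetric matrices *)

Section Spectral.
Local Open Scope sesquilinear_scope.
Variables (R : realType) (n : nat) (A : 'M[R]_n).
Hypothesis A_sym : A^T = A.
Local Notation C := R[i]%C.
Let toC := real_complex R.

Definition qform (v : 'rV[R]_n) : R := (v *m A *m v^T) 0 0.

Lemma real_spectral : exists (P : 'M[C]_n) (r : 'I_n -> R),
  [/\ P \is unitarymx, map_mx toC A = P^t* *m diag_mx (\row_i toC (r i)) *m P &
    perm_eq (spectrum A) [seq r i | i <- enum 'I_n]].
Proof.
have Ah : map_mx toC A \is hermsymmx.
  apply: realsym_hermsym; last first.
    by apply/mxOverP => i j; rewrite mxE; apply/complex_realP; exists (A i j).
  apply/is_hermitianmxP; rewrite expr0 scale1r map_mx_id //.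
  by apply/matrixP => i j; rewrite !mxE -[in LHS]A_sym mxE.
have /mxOverP dreal := hermitian_spectral_diag_real Ah.
have /orthomx_spectralP := hermitian_normalmx Ah.
set P := spectralmx _; set d := spectral_diag _ in dreal * => AE.
have PU : P \is unitarymx by exact: spectral_unitarymx.
rewrite invmx_unitary // in AE.
pose r i := complex.Re (d 0 i).
have dE : d = \row_i toC (r i).
  apply/rowP => i; rewrite mxE; have /complex_realP[x dx] := dreal 0 i.
  by rewrite /r /toC dx.
exists P, r; split; [by [] | by rewrite -dE |].
have [_ pE] := spectrumP A_sym.
apply: prod_XsubC_eq; rewrite -pE big_map big_enum /=.
apply: (map_poly_inj (real_complex R)).
rewrite map_char_poly -/toC AE rmorph_prod /=.
have -> : char_poly (P^t* *m diag_mx d *m P) = char_poly (diag_mx d).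
  rewrite /char_poly /char_poly_mx !map_mxM /=.
  have PV : map_mx polyC (P^t*) *m map_mx polyC P = 1%:M.
    by rewrite -map_mxM -invmx_unitary // mulVmx ?unitarymx_unit // map_mx1.
  have -> : 'X%:M - map_mx polyC (P^t*) *m map_mx polyC (diag_mx d) *m map_mx polyC P =
      map_mx polyC (P^t*) *m ('X%:M - map_mx polyC (diag_mx d)) *m map_mx polyC P.
    by rewrite mulmxBr mulmxBl mul_mx_scalar -scalemxAl PV scalemx1.
  by rewrite !det_mulmx mulrAC -det_mulmx PV det1 mul1r.
rewrite char_poly_trig ?diag_mx_is_trig //.
apply: eq_bigr => i _; rewrite mxE eqxx mulr1n rmorphB /= map_polyX map_polyC /=.
by rewrite dE mxE.
Qed.

Definition sqn (z : C) : R := complex.Re z ^+ 2 + complex.Im z ^+ 2.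

Lemma sqn_ge0 z : 0 <= sqn z.
Proof. by rewrite addr_ge0 ?sqr_ge0. Qed.

Lemma mul_conj_sqn (z : C) : z * z^* = toC (sqn z).
Proof.
case: z => x y; rewrite /sqn /toC /=; apply/eqP; rewrite eq_complex /=.
by apply/andP; split; apply/eqP; ring.
Qed.

Lemma Re_sum (I : finType) (F : I -> C) :
  complex.Re (\sum_i F i) = \sum_i complex.Re (F i).
Proof. by apply: (big_morph _ (id1 := 0)) => // -[? ?] [? ?]. Qed.

Let M := map_mx toC A.

Lemma qformE (v : 'rV[R]_n) : qform v = \sum_j \sum_i v 0 i * A i j * v 0 j.
Proof.
rewrite /qform mxE; apply: eq_bigr => j _; rewrite !mxE mulr_suml.
by apply: eq_bigr => i _.
Qed.

(** The entries of [A] are real, so real and imaginary parts decouple. This carries the complex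
    unitary diagonalization over to the real form. *)
Lemma Re_form (z : 'rV[C]_n) : complex.Re ((z *m M *m z^t*) 0 0) =
  qform (map_mx (@complex.Re R) z) + qform (map_mx (@complex.Im R) z).
Proof.
rewrite !qformE mxE Re_sum -big_split /=; apply: eq_bigr => j _.
rewrite !mxE mulr_suml Re_sum -big_split /=; apply: eq_bigr => i _.
rewrite !mxE; case: (z 0 i) => x y; case: (z 0 j) => x' y' /=.
by rewrite /toC /=; ring.
Qed.

Lemma Re_norm (z : 'rV[C]_n) : complex.Re ((z *m z^t*) 0 0) = \sum_i sqn (z 0 i).
Proof.
rewrite mxE Re_sum; apply: eq_bigr => i _; rewrite !mxE.
by rewrite mul_conj_sqn.
Qed.

Section Diag.
Variables (P : 'M[C]_n) (r : 'I_n -> R).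
Hypothesis PU : P \is unitarymx.
Hypothesis AE : M = P^t* *m diag_mx (\row_i toC (r i)) *m P.

Lemma form_diag (y : 'rV[C]_n) :
  qform (map_mx (@complex.Re R) (y *m P)) + qform (map_mx (@complex.Im R) (y *m P)) =
  \sum_i r i * sqn (y 0 i).
Proof.
rewrite -Re_form AE trmx_mul map_mxM /= !mulmxA !mulmxtVK //.
rewrite mxE Re_sum; apply: eq_bigr => i _.
by rewrite mul_mx_diag !mxE mulrAC mul_conj_sqn -rmorphM /= mulrC.
Qed.

Lemma norm_diag (y : 'rV[C]_n) : \sum_i sqn ((y *m P) 0 i) = \sum_i sqn (y 0 i).
Proof. by rewrite -!Re_norm trmx_mul map_mxM /= mulmxA mulmxtVK. Qed.

End Diag.

Lemma Re_Im_norm (z : 'rV[C]_n) :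
  \sum_i complex.Re (z 0 i) ^+ 2 + \sum_i complex.Im (z 0 i) ^+ 2 = \sum_i sqn (z 0 i).
Proof. by rewrite -big_split. Qed.

Lemma spectrum0_le (v : 'rV[R]_n) : (spectrum A)`_0 * \sum_i v 0 i ^+ 2 <= qform v.
Proof.
have [P [r [PU AE pe]]] := real_spectral.
have r_ge i : (spectrum A)`_0 <= r i.
  have : r i \in spectrum A by rewrite (perm_mem pe) map_f ?mem_enum.
  have [+ _] := spectrumP A_sym; case: (spectrum A) => //= x s.
  by move=> /(order_path_min le_trans)/allP xs; rewrite inE => /predU1P[->//|/xs].
pose y := map_mx toC v *m P^t*.
have yP : y *m P = map_mx toC v by rewrite mulmxKtV.
have := form_diag PU AE y; have := norm_diag PU y; rewrite yP.
have -> : map_mx (@complex.Re R) (map_mx toC v) = v by apply/rowP => i; rewrite !mxE.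
have -> : map_mx (@complex.Im R) (map_mx toC v) = 0 by apply/rowP => i; rewrite !mxE.
have -> : qform 0 = 0 by rewrite /qform !mul0mx mxE.
rewrite addr0 => nE ->.
have -> : \sum_i v 0 i ^+ 2 = \sum_i sqn (y 0 i).
  by rewrite -nE; apply: eq_bigr => i _; rewrite mxE /sqn /= expr0n addr0.
by rewrite mulr_sumr; apply: ler_sum => i _; rewrite ler_wpM2r ?sqn_ge0.
Qed.

(* Some combination of the two lowest eigenvectors vanishes at [m]. *)
Lemma spectrum1_ge (m : 'I_n) (t : R) : (1 < n)%N ->
  (forall v : 'rV[R]_n, v 0 m = 0 -> t * \sum_i v 0 i ^+ 2 <= qform v) ->
  t <= (spectrum A)`_1.
Proof.
move=> n1 tq; have [P [r [PU AE pe]]] := real_spectral.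
have [srt _] := spectrumP A_sym; have sz := size_spectrum A_sym.
(* Two distinct indices, not two distinct eigenvalues: a degenerate lowest eigenvalue is covered. *)
have [i [j [ij ri rj]]] : exists i j, [/\ i != j, r i <= (spectrum A)`_1 & r j <= (spectrum A)`_1].
  have /(perm_iotaP 0)[Is pIs eE] := pe.
  rewrite size_map size_enum_ord in pIs.
  have szI : size Is = n by rewrite (perm_size pIs) size_iota.
  have Iu : uniq Is by rewrite (perm_uniq pIs) iota_uniq.
  have lt k : (k < n)%N -> (nth 0%N Is k < n)%N.
    by move=> kn; have := mem_nth 0%N (_ : (k < size Is)%N); rewrite szI => /(_ kn);
       rewrite (perm_mem pIs) mem_iota.
  have rE k (kn : (k < n)%N) : r (Ordinal (lt k kn)) = (spectrum A)`_k.
    rewrite eE (nth_map 0%N) ?szI // (nth_map (Ordinal kn)) ?size_enum_ord ?lt //.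
    by congr r; apply: val_inj; rewrite /= nth_enum_ord ?lt.
  exists (Ordinal (lt 0%N (ltnW n1))), (Ordinal (lt 1%N n1)); rewrite !rE; split => //.
    by rewrite -val_eqE /= nth_uniq ?szI // ltnW.
  by apply: (sorted_leq_nth le_trans lexx 0 srt) => //; rewrite inE sz // ltnW.
have [al [be [ab0 abm]]] : exists al be : C, 0 < sqn al + sqn be /\ al * P i m + be * P j m = 0.
  have sqn_gt0 z : z != 0 -> 0 < sqn z.
    rewrite lt0r sqn_ge0 andbT; case: z => x y.
    by rewrite eq_complex /sqn /= paddr_eq0 ?sqr_ge0 // !sqrf_eq0.
  have [Pi0|Pi0] := eqVneq (P i m) 0.
    exists 1, 0; rewrite Pi0 mulr0 mul0r addr0; split => //.
    by apply: ltr_pwDl; rewrite ?sqn_ge0 ?sqn_gt0 ?oner_eq0.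
  exists (P j m), (- P i m); split; last by ring.
  by apply: ltr_wpDl; rewrite ?sqn_ge0 ?sqn_gt0 ?oppr_eq0.
pose y : 'rV[C]_n := \row_k (if k == i then al else if k == j then be else 0).
have sum2 (F : 'I_n -> R) : (forall k, k != i -> k != j -> F k = 0) -> \sum_k F k = F i + F j.
  move=> F0; rewrite (bigD1 i) // (bigD1 j) 1?eq_sym //= big1 ?addr0 //.
  by move=> k /andP[ki kj]; exact: F0.
have yi : y 0 i = al by rewrite mxE eqxx.
have yj : y 0 j = be by rewrite mxE eq_sym (negPf ij) eqxx.
have y0 k : k != i -> k != j -> y 0 k = 0 by move=> ki kj; rewrite mxE (negPf ki) (negPf kj).
have sqn0 : sqn 0 = 0 by rewrite /sqn /= expr0n addr0.
have zm : (y *m P) 0 m = 0.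
  rewrite mxE (bigD1 i) // (bigD1 j) 1?eq_sym //= big1; last first.
    by move=> k /andP[ki kj]; rewrite y0 ?mul0r.
  by rewrite addr0 yi yj.
have := form_diag PU AE y; rewrite sum2; last by move=> k ki kj; rewrite y0 // sqn0 mulr0.
have := norm_diag PU y; rewrite [RHS]sum2; last by move=> k ki kj; rewrite y0.
rewrite -Re_Im_norm yi yj => nE fE.
(* The combination is complex, but its real and imaginary parts are real vectors that vanish at
   [m]. *)
have := tq (map_mx (@complex.Re R) (y *m P)); rewrite mxE zm => /(_ erefl) h1.
have := tq (map_mx (@complex.Im R) (y *m P)); rewrite mxE zm => /(_ erefl) h2.
have h : t * (sqn al + sqn be) <= r i * sqn al + r j * sqn be.
  rewrite -fE -nE mulrDr; apply: lerD; [apply: le_trans h1 | apply: le_trans h2];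
    by rewrite le_eqVlt; apply/orP; left; apply/eqP/(congr1 ( *%R t)); apply: eq_bigr => k _; rewrite [in RHS]mxE.
rewrite -(ler_pM2r ab0); apply: le_trans h _; rewrite [leRHS]mulrDr.
by apply: lerD; apply: ler_wpM2r => //; exact: sqn_ge0.
Qed.

Lemma spectrum0_eigen : (0 < n)%N ->
  exists2 v : 'rV[R]_n, v != 0 & v *m A = (spectrum A)`_0 *: v.
Proof.
move=> n0; have [_ pE] := spectrumP A_sym.
have : root (char_poly A) (spectrum A)`_0.
  by rewrite pE root_prod_XsubC mem_nth // size_spectrum.
by rewrite -eigenvalue_root_char => /eigenvalueP[v vA v0]; exists v.
Qed.

End Spectral.

Section Symmetric.
Variables (R : realType) (n : nat) (A : 'M[R]_n).
Hypothesis A_sym : A^T = A.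

Let A_symE i j : A i j = A j i.
Proof. by rewrite -[in LHS]A_sym mxE. Qed.

(* Barta's trick: a positive supersolution [w] bounds the form from below,
   by [2 x y <= x^2 (w' / w) + y^2 (w / w')]. *)
Lemma qform_ge_supersolution (m : 'I_n) (w : 'rV[R]_n) (t : R) (v : 'rV[R]_n) :
  (forall i j, i != j -> A i j <= 0) ->
  w 0 m = 0 -> (forall i, i != m -> 0 < w 0 i) ->
  (forall i, i != m -> t * w 0 i <= (w *m A) 0 i) ->
  v 0 m = 0 -> t * \sum_i v 0 i ^+ 2 <= qform A v.
Proof.
move=> Aoff wm w_gt0 sup vm; set x := v 0.
(* Row [m] of [F] is zero because [v] vanishes at [m], column [m] because [w] does. Symmetrising [F]
   then allows a comparison with the form pair by pair. *)
pose F i j := A i j * w 0 j * (x i ^+ 2 / w 0 i).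
have FE : \sum_i \sum_j (F i j + F j i) / 2 = \sum_i \sum_j F i j.
  under eq_bigr do rewrite -mulr_suml big_split /=.
  by rewrite -mulr_suml big_split /= [X in _ + X]exchange_big /=; field.
apply: (@le_trans _ _ (\sum_i \sum_j F i j)).
  rewrite mulr_sumr; apply: ler_sum => i _.
  have [->|im] := eqVneq i m.
    rewrite /x vm expr0n mulr0 big1 // => j _.
    by rewrite /F /x vm expr0n mul0r mulr0.
  rewrite -mulr_suml mulrA ler_pdivlMr ?w_gt0 // mulrAC [leRHS]mulrC.
  rewrite [leRHS](_ : _ = x i ^+ 2 * (w *m A) 0 i); last first.
    by rewrite mxE; congr (_ * _); apply: eq_bigr => j _; rewrite mulrC A_symE.
  by rewrite mulrC ler_wpM2l ?sqr_ge0 // sup.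
rewrite -FE qformE exchange_big /=; apply: ler_sum => i _; apply: ler_sum => j _.
rewrite -/x /F A_symE.
have [->|ij] := eqVneq i j.
  have [->|jm] := eqVneq j m; first by rewrite /x vm !expr0n /= !(mul0r, mulr0) addr0 mul0r.
  rewrite le_eqVlt; apply/orP; left; apply/eqP; field.
  by rewrite gt_eqF ?w_gt0.
have Aij : A i j <= 0 by exact: Aoff.
have [->|im] := eqVneq i m.
  by rewrite /x vm wm !expr0n /= !(mul0r, mulr0, addr0).
have [->|jm] := eqVneq j m.
  by rewrite /x vm wm !expr0n /= !(mul0r, mulr0, addr0).
have wi := w_gt0 _ im; have wj := w_gt0 _ jm.
rewrite [leLHS](_ : _ = A i j * ((x i ^+ 2 * w 0 j ^+ 2 + x j ^+ 2 * w 0 i ^+ 2) / (2 * (w 0 i * w 0 j)))); last first.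
  by field; rewrite !gt_eqF.
rewrite [leRHS](_ : _ = A i j * (x i * x j)); last by ring.
apply: ler_wnM2l => //.
rewrite ler_pdivlMr; last by rewrite !mulr_gt0.
have := sqr_ge0 (x i * w 0 j - x j * w 0 i); nra.
Qed.

(** [v] minimises the form minus [t] times the squared norm. Moving along the residual
    [v *m A - t *: v] changes this, to first order, by twice the squared norm of the residual, which
    must therefore vanish. *)
Lemma qform_min_eigen (t : R) (v : 'rV[R]_n) :
  (forall u : 'rV[R]_n, t * \sum_i u 0 i ^+ 2 <= qform A u) ->
  qform A v <= t * \sum_i v 0 i ^+ 2 -> v *m A = t *: v.
Proof.
move=> tq qv; pose g := v *m A - t *: v.
pose B (u : 'rV[R]_n) := qform A u - t * \sum_i u 0 i ^+ 2.
have B_ge0 u : 0 <= B u by rewrite subr_ge0.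
have BE (x : 'rV[R]_n) a : B (v + a *: x) =
    B v + 2 * a * ((x *m A *m v^T) 0 0 - t * \sum_i x 0 i * v 0 i) + a ^+ 2 * B x.
  have e : (v *m A *m x^T) 0 0 = (x *m A *m v^T) 0 0.
    by rewrite -[in LHS](trmxK (v *m A *m x^T)) mxE !trmx_mul trmxK A_sym mulmxA.
  rewrite /B; have -> : \sum_i (v + a *: x) 0 i ^+ 2 =
      \sum_i v 0 i ^+ 2 + 2 * a * (\sum_i x 0 i * v 0 i) + a ^+ 2 * \sum_i x 0 i ^+ 2.
    rewrite !mulr_sumr -!big_split /=; apply: eq_bigr => i _.
    by rewrite !mxE; ring.
  rewrite /qform; have -> : (v + a *: x) *m A *m (v + a *: x)^T = v *m A *m v^T +
      a *: (v *m A *m x^T) + a *: (x *m A *m v^T) + a *: (a *: (x *m A *m x^T)).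
    rewrite linearD linearZ /= !mulmxDl !mulmxDr.
    by rewrite !(=^~ scalemxAl, =^~ scalemxAr) !addrA.
  move: (v *m A *m v^T) (v *m A *m x^T) (x *m A *m v^T) (x *m A *m x^T) e => X1 X2 X3 X4 e.
  by rewrite !mxE e; ring.
have gE : (g *m A *m v^T) 0 0 - t * (\sum_i g 0 i * v 0 i) = \sum_i g 0 i ^+ 2.
  have -> : g *m A *m v^T = g *m (v *m A)^T by rewrite trmx_mul A_sym mulmxA.
  rewrite mxE mulr_sumr -sumrB; apply: eq_bigr => i _.
  by rewrite !mxE; ring.
have {}BE a := BE g a; rewrite {}gE in BE.
have s_ge0 : 0 <= \sum_i g 0 i ^+ 2 by rewrite sumr_ge0 // => i _; rewrite sqr_ge0.
have Bv : B v <= 0 by rewrite subr_le0.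
suff s0 : \sum_i g 0 i ^+ 2 = 0.
  apply/eqP; rewrite -subr_eq0; apply/eqP/rowP => i; rewrite [RHS]mxE.
  have : all (fun j => g 0 j ^+ 2 == 0) (enum 'I_n).
    move/eqP: s0; rewrite psumr_eq0 => [|j _]; last exact: sqr_ge0.
    by move=> /allP h; apply/allP => j _; apply: h; rewrite mem_index_enum.
  by move=> /allP/(_ i); rewrite mem_enum => /(_ isT); rewrite sqrf_eq0 => /eqP.
set s := \sum_i _ in BE s_ge0 *.
have [Bg0|Bg0] := lerP (B g) 0.
  by have := B_ge0 (v + (-1) *: g); rewrite BE; lra.
have := B_ge0 (v + (- (s / B g)) *: g); rewrite BE.
have -> : B v + 2 * - (s / B g) * s + (- (s / B g)) ^+ 2 * B g = B v - s ^+ 2 / B g.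
  by field; rewrite gt_eqF.
move=> h; have : s ^+ 2 / B g <= 0 by lra.
rewrite pmulr_lle0 ?invr_gt0 // => h2.
by apply/eqP; rewrite -sqrf_eq0 eq_le h2 sqr_ge0.
Qed.

(* Hence the ground state may be taken nonnegative. *)
Lemma qform_abs (v : 'rV[R]_n) : (forall i j, i != j -> A i j <= 0) ->
  qform A (map_mx Num.norm v) <= qform A v.
Proof.
move=> Aoff; rewrite !qformE; apply: ler_sum => j _; apply: ler_sum => i _; rewrite !mxE.
have [->|ij] := eqVneq i j; first by rewrite mulrAC -normrM mulrAC -!expr2 ger0_norm ?sqr_ge0.
have := ler_norm (v 0 i * v 0 j); rewrite normrM; have := Aoff _ _ ij.
by nra.
Qed.

End Symmetric.

(** * Tridiagonal matrices *)

Section Tridiagonal.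
Variables (R : realType) (n : nat) (c : R) (W : nat -> R) (A : 'M[R]_n.+1).
Local Notation K := (hop n c).
Hypothesis c_gt0 : 0 < c.
Hypothesis A_sym : A^T = A.
Hypothesis AE : forall i j, A i j =
  W i *+ (i == j) - K j *+ (i.+1 == j :> nat) - K i *+ (i == j.+1 :> nat).

Lemma tridiag_off i j : i != j -> A i j <= 0.
Proof.
move=> ij; rewrite AE (negPf ij) mulr0n sub0r -opprD oppr_le0.
by rewrite addr_ge0 // mulrn_wge0 // hop_ge0.
Qed.

Lemma sum_pick (x : nat -> R) (a : R) (j : nat) : (j <= n)%N \/ a = 0 ->
  \sum_(i < n.+1) x i * (a *+ (i == j :> nat)) = x j * a.
Proof.
move=> [jn|->]; last by rewrite mulr0 big1 // => i _; rewrite mul0rn mulr0.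
rewrite (bigD1 (Ordinal (jn : (j < n.+1)%N))) //= eqxx mulr1n big1 ?addr0 // => i ij.
by rewrite (_ : (i == j :> nat) = false) ?mulr0n ?mulr0 //; apply: negbTE.
Qed.

(** The terms with [x k.-1] at [k = 0] and [x k.+1] at [k = n] correspond to no matrix entry; their
    factors [K 0] and [K n.+1] vanish. *)
Lemma tridiag_row (x : nat -> R) (k : 'I_n.+1) :
  ((\row_i x i) *m A) 0 k = W k * x k - K k * x k.-1 - K k.+1 * x k.+1.
Proof.
rewrite mxE.
transitivity (\sum_(i < n.+1) (x i * (W k *+ (i == k :> nat))
   - x i * (K k *+ (i.+1 == k :> nat)) - x i * (K k.+1 *+ (i == k.+1 :> nat)))).
  apply: eq_bigr => i _; rewrite mxE AE -!mulrBr; congr (_ * (_ - _ - _)).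
    by rewrite -val_eqE /=; case: eqP => [->|].
  by case: eqP => [->|].
rewrite !sumrB !sum_pick; last 2 first.
- have [kn|nk] := ltnP k n; [by left | right].
  by rewrite (_ : k = n :> nat) ?hop_last //; have := ltn_ord k; lia.
- by left; rewrite -ltnS ltn_ord.
rewrite mulrC; congr (_ - _ - _); last by rewrite mulrC.
case: (nat_of_ord k) (ltn_ord k) => [|j] jn /=.
  by rewrite hop0 mul0r big1 // => i _; rewrite mulr0n mulr0.
by rewrite [RHS]mulrC -sum_pick //; left; lia.
Qed.

(** Perron-Frobenius on a path: the absolute value of a ground state is again a minimiser, hence an
    eigenvector. The off-diagonal terms have one sign, so a zero of it would spread to the
    neighbours and along the whole chain. *)
Lemma ground_state : exists phi : nat -> R, (forall k, 0 < phi k) /\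
  forall k, (k <= n)%N -> W k * phi k - K k * phi k.-1 - K k.+1 * phi k.+1 =
    (spectrum A)`_0 * phi k.
Proof.
have [v v0 vA] := spectrum0_eigen A_sym (ltn0Sn n).
set e := (spectrum A)`_0 in vA *.
pose w := map_mx Num.norm v.
have wA : w *m A = e *: w.
  apply: (qform_min_eigen A_sym) => [u|]; first exact: spectrum0_le.
  apply: le_trans (qform_abs _ tridiag_off) _.
  rewrite /qform vA -scalemxAl mxE mxE le_eqVlt; apply/orP; left; apply/eqP.
  congr (_ * _); apply: eq_bigr => i _; rewrite !mxE -expr2.
  by rewrite real_normK ?num_real.
(* The value 1 beyond [n] keeps [phi] positive on all naturals; in the equations it only meets the
   factor [K n.+1 = 0]. *)
pose x k : R := if (k <= n)%N then w 0 (inord k) else 1.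
have wE : w = \row_i x i.
  by apply/rowP => i; rewrite [RHS]mxE /x -ltnS ltn_ord inord_val.
have x_ge0 k : 0 <= x k by rewrite /x; case: ifP => // _; rewrite mxE.
have eqn k : (k <= n)%N -> W k * x k - K k * x k.-1 - K k.+1 * x k.+1 = e * x k.
  move=> kn; have := tridiag_row x (inord k); rewrite inordK // => <-.
  by rewrite -wE wA mxE wE mxE inordK.
have zero k : (k <= n)%N -> x k = 0 -> K k * x k.-1 = 0 /\ K k.+1 * x k.+1 = 0.
  move=> kn xk; have := eqn k kn; rewrite xk !mulr0 sub0r.
  have h1 : 0 <= K k * x k.-1 by rewrite mulr_ge0 ?hop_ge0.
  have h2 : 0 <= K k.+1 * x k.+1 by rewrite mulr_ge0 ?hop_ge0.
  by split; lra.
have K0 k : (0 < k <= n)%N -> K k != 0 by move=> kn; rewrite gt_eqF // hop_gt0.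
have down k : (k <= n)%N -> x k = 0 -> x 0%N = 0.
  elim: k => // k IH kn xk; have [/eqP + _] := zero _ kn xk.
  by rewrite mulf_eq0 (negPf (K0 k.+1 _)) //= => /eqP; apply: IH; lia.
have up k : x 0%N = 0 -> (k <= n)%N -> x k = 0.
  move=> x00; elim: k => // k IH kn; have [_ /eqP] := zero _ (ltnW kn) (IH (ltnW kn)).
  by rewrite mulf_eq0 (negPf (K0 k.+1 _)) //= => /eqP.
exists x; split => // k; rewrite lt0r x_ge0 andbT; apply/eqP => xk.
have kn : (k <= n)%N by apply: contraT => kn; move: xk; rewrite /x (negPf kn) => /eqP; rewrite oner_eq0.
have x00 := down _ kn xk.
move/eqP: v0; apply; apply/rowP => i; rewrite [RHS]mxE.
have := up i x00 ltac:(by rewrite -ltnS); rewrite /x -ltnS ltn_ord inord_val mxE.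
by move=> /eqP; rewrite normr_eq0 => /eqP.
Qed.

Section Ground.
Variables (phi S U : nat -> R) (e : R).
Hypothesis phi_gt0 : forall k, 0 < phi k.
Hypothesis phiE : forall k, (k <= n)%N ->
  W k * phi k - K k * phi k.-1 - K k.+1 * phi k.+1 = e * phi k.
Hypothesis WE : forall k, W k = S k + U k + e.
Hypothesis U_ge0 : forall k, 0 <= U k.
Hypothesis S_cvx : forall k, (k.+2 <= n)%N -> S k.+1 - S k <= S k.+2 - S k.+1.

Definition ground_b k := K k.+1 * phi k.+1 / phi k.
Definition ground_d k := K k * phi k.-1 / phi k.
Local Notation b := ground_b.
Local Notation d := ground_d.

Lemma ground_rates : rates n c S U b d.
Proof.
split => //; rewrite /b /d.
- by rewrite hop0 !mul0r.
- by rewrite hop_last !mul0r.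
- by move=> k kn; rewrite divr_gt0 // mulr_gt0 // hop_gt0.
- by move=> k kn; rewrite divr_gt0 // mulr_gt0 // hop_gt0.
- by move=> k kn /=; field; rewrite !gt_eqF.
move=> k kn; have := phiE kn; rewrite WE => h.
have pk : phi k != 0 by rewrite gt_eqF.
rewrite -mulrDl; apply: (canLR (mulfK pk)); lra.
Qed.

Lemma ground_b_phi k : b k * phi k = K k.+1 * phi k.+1.
Proof. by rewrite /b divfK // gt_eqF. Qed.

Lemma ground_d_phi k : d k.+1 * phi k.+1 = K k.+1 * phi k.
Proof. by rewrite /d divfK // gt_eqF. Qed.

(** Ground state transform: on [phi * g], [A - e] acts as [phi] times the birth-death operator on
    [g]. The two one-sided solutions, glued at their common zero [m], thus give the supersolution
    for Barta's trick. *)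
Lemma dirichlet_ge (delta : R) (m : nat) (G G' : nat -> R) : (m <= n)%N ->
  right_solution n b d delta m G ->
  right_solution n (fun k => d (n - k)%N) (fun k => b (n - k)%N) delta (n - m) G' ->
  forall v : 'rV[R]_n.+1, v 0 (inord m) = 0 -> (e + delta) * \sum_i v 0 i ^+ 2 <= qform A v.
Proof.
move=> mn [Gm G_gt0 Gs] [Gm' G_gt0' Gs'] v vm.
pose g k := if (k <= m)%N then G' (n - k)%N else G k.
have gG k : (m <= k)%N -> g k = G k.
  rewrite leq_eqVlt => /orP[/eqP<-|mk]; last by rewrite /g leqNgt mk.
  by rewrite /g leqnn Gm Gm'.
pose om : 'rV[R]_n.+1 := \row_i (phi i * g i).
have ordm (i : 'I_n.+1) : i != inord m -> i != m :> nat by rewrite -val_eqE /= inordK.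
apply: (qform_ge_supersolution A_sym (m := inord m) (w := om)) => //.
- exact: tridiag_off.
- by rewrite mxE inordK // gG // Gm mulr0.
- move=> i /ordm im; rewrite mxE mulr_gt0 // /g; have := ltn_ord i => in1.
  by case: leqP => mi; [apply: G_gt0'; lia | apply: G_gt0; lia].
move=> i /ordm im; have in1 := ltn_ord i.
rewrite (tridiag_row (fun k => phi k * g k)) mxE.
have key : delta * g i <= d i * (g i - g i.-1) - b i * (g i.+1 - g i).
  have [mi|im'] := ltnP m i.
    by rewrite !gG; [apply: Gs | ..]; lia.
  have im2 : (i < m)%N by lia.
  rewrite /g (ltnW im2) im2 (leq_trans (leq_pred i) im').
  have := Gs' (n - i)%N ltac:(lia); rewrite subKn; last by lia.
  rewrite (_ : (n - i).-1 = n - i.+1)%N; last by lia.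
  (* At site 0 the index [(n - i).+1] is not [n - i.-1], but the term carries the factor
     [d 0 = 0]. *)
  have [i0|i0] := posnP i; last by rewrite (_ : (n - i).+1 = n - i.-1)%N; [lra | lia].
  have -> : d i = 0 by rewrite /d i0 hop0 !mul0r.
  by lra.
have Wi := phiE (_ : (i <= n)%N); rewrite -ltnS in Wi; have {}Wi := Wi in1.
rewrite [leRHS](_ : _ = phi i * (e * g i + (d i * (g i - g i.-1) - b i * (g i.+1 - g i)))).
  by rewrite mulrCA ler_pM2l // mulrDl lerD2l.
have pi : phi i != 0 by rewrite gt_eqF.
have -> : W i = (e * phi i + K i * phi i.-1 + K i.+1 * phi i.+1) / phi i.
  by rewrite -Wi; field.
by rewrite /b /d; field.
Qed.

End Ground.
End Tridiagonal.

(** * Choice of the Dirichlet site, weak hopping and absent barriers *)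

Section Solutions.
Variables (R : realType) (n : nat) (c : R) (S U b d : nat -> R).
Local Notation K := (hop n c).
Hypothesis c_gt0 : 0 < c.
Hypothesis rt : rates n c S U b d.

(* [b m <= K m.+1] says that the ground state does not increase from [m] to
   [m.+1], so [m] is its first local maximum. *)
Definition first_max (m : nat) :=
  [/\ (m <= n)%N, (m < n)%N -> b m <= K m.+1 & forall k, (k < m)%N -> K k.+1 < b k].

Lemma first_max_exists : exists m, first_max m.
Proof.
have ex : exists m, (m == n) || (b m <= K m.+1) by exists n; rewrite eqxx.
case: (ex_minnP ex) => m /orP mP mmin; exists m; split.
- by apply: mmin; rewrite eqxx.
- by case: mP => [/eqP->|//]; rewrite ltnn.
- move=> k km; rewrite ltNge; apply/negP => bk.
  by have := mmin k; rewrite bk orbT => /(_ isT); rewrite leqNgt km.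
Qed.

Lemma first_max_d m k : first_max m -> (k < m)%N -> d k.+1 < K k.+1.
Proof.
move=> [mn _ bm] km; have kn : (k < n)%N by lia.
by rewrite -(gt_geometric_mean (rates_b_gt0 rt kn) (rates_d_gt0 rt kn) (hop_ge0 _ c_gt0 _) (rates_bd rt kn)) bm.
Qed.

(** The rise of [phi] into [m] is the condition on the mirror image, so one site serves both
    sides. *)
Lemma first_max_rev m : first_max m -> (n - m < n)%N -> d (n - (n - m))%N <= K (n - m).+1.
Proof.
move=> fm nm; have [mn _ _] := fm; rewrite subKn //.
have mE : m = m.-1.+1 by lia.
rewrite (_ : (n - m).+1 = n.+1 - m)%N ?hop_rev //; try lia.
by rewrite mE; apply/ltW/(first_max_d fm); lia.
Qed.

(** The potential does all the work: [S k >= nu * k], while the amplitudes are at most [kappa0 * k],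
    so the drift is linear from site 1 on and site 0 can carry the Dirichlet condition. *)
Lemma small_hop_solution (nu kappa0 delta : R) :
  (forall k, (k < n)%N -> nu <= S k.+1 - S k) -> U 0 = 0 ->
  8 * kappa0 <= nu -> K 1 <= kappa0 -> 8 * delta <= nu -> 0 < delta ->
  right_solution n b d delta 0 (ramp R 0).
Proof.
move=> dS U0 k0nu K1 dnu d_gt0.
have K1_ge0 : 0 <= K 1 by exact: hop_ge0.
have S_ge k : (k <= n)%N -> nu * k%:R <= S k.
  elim: k => [|k IH] kn.
    have := rates_eq rt kn; rewrite (rates_d0 rt) U0 !addr0 mulr0 => <-.
    exact: (rates_b_ge0 rt kn).
  by have := IH (ltnW kn); have := dS k kn; rewrite -(natr1 k); lra.
have K_le k : (0 < k)%N -> (k <= n.+1)%N -> K k <= kappa0 * k%:R.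
  move=> k_gt0; rewrite leq_eqVlt => /orP[/eqP->|kn].
    by rewrite hop_last mulr_ge0 //; lra.
  have k1 : 1 <= (k%:R : R) by rewrite ler1n.
  rewrite -ler_sqr ?nnegrE ?hop_ge0 //; last by rewrite mulr_ge0 //; lra.
  have hm : K k ^+ 2 <= K 1 ^+ 2 * k%:R by apply: hop_mono; rewrite ?k_gt0.
  apply: le_trans hm _.
  have : K 1 ^+ 2 <= kappa0 ^+ 2 by rewrite ler_sqr ?nnegrE; lra.
  move=> h; rewrite [leRHS]exprMn; apply: ler_pM => //.
    exact: sqr_ge0.
  by rewrite expr2 ler_peMr // ler0n.
have Kd : forall j, (1 <= j <= n)%N -> K j <= d j.
  apply: (hop_le_d c_gt0 rt) => j jn.
  have j1 : 1 <= (j%:R : R) by rewrite ler1n; lia.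
  have := K_le j ltac:(lia_nat) ltac:(lia_nat); have := K_le j.+1 ltac:(lia_nat) ltac:(lia_nat).
  have := S_ge j ltac:(lia_nat); rewrite -(natr1 j); nra.
have drift k : (0 < k <= n)%N -> nu / 2 * k%:R <= d k - b k.
  move=> kn; have k1 : 1 <= (k%:R : R) by rewrite ler1n; lia_nat.
  have bk : b k <= kappa0 * (k%:R + 1).
    have [kn'|nk] := ltnP k n.
      apply: le_trans (_ : K k.+1 <= _); last by rewrite natr1; apply: K_le; lia_nat.
      by rewrite (rates_b_hop c_gt0 rt) // Kd //; lia_nat.
    rewrite (_ : k = n) ?(rates_bn rt); last by lia_nat.
    by apply: mulr_ge0; [lra | rewrite addr_ge0].
  have := rates_eq rt (k := k) ltac:(lia_nat); have := S_ge k ltac:(lia_nat).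
  have := rates_U_ge0 rt k; nra.
apply: ramp_right_solution => [n0|k kn].
  have := drift 1%N ltac:(lia_nat); have := rates_d_ge0 rt n0.
  by rewrite mulr1; lra.
have k2 : 2 <= (k%:R : R) by rewrite ler_nat; lia_nat.
by apply: le_trans (drift k _); [nra | lia_nat].
Qed.

Lemma free_right_solution (phi : nat -> R) (m : nat) (kappa kappa0 delta : R) :
  (0 < n)%N -> (forall k, U k = 0) ->
  (forall k, 0 < phi k) ->
  (forall k, (k <= n)%N -> b k * phi k = K k.+1 * phi k.+1) ->
  (forall k, (k < n)%N -> d k.+1 * phi k.+1 = K k.+1 * phi k) ->
  kappa <= 2 * c \/ (forall k, (k < n)%N -> kappa <= `|S k.+1 - S k|) ->
  (m <= n)%N -> ((m < n)%N -> b m <= K m.+1) ->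
  0 < kappa -> kappa0 <= K 1 ->
  0 < delta -> 16 * delta <= kappa -> 2 * delta <= kappa0 ->
  exists G, right_solution n b d delta m G.
Proof.
move=> n0 U0 phi_gt0 b_phi d_phi slope mn bm kap0 K1 d0 dk dk0.
(* The empty barrier [l = u = 1] has [T = 0]. Two is the least [N] that [N_ge] allows, and
   [kz = 16 * delta] is what [delta_zone] then asks for. *)
apply: (@right_solution_exists R n c S U b d phi 1 1 m 2 kappa kappa0 0 (16 * delta) 1 1 1 delta) => //.
- by move=> i j; rewrite big1.
- by move=> k kn; apply: le_trans K1 _; apply: hop1_le.
- lra.
- lra.
- lra.
- by rewrite mul0r addr0 expr1n.
- by rewrite !expr1n; lra.
- by rewrite !expr1n; lra.
Qed.

End Solutions.

Lemma nat_between (R : realType) (x : R) : 1 <= x -> exists N : nat, x <= N%:R <= x + 1.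
Proof.
move=> x1; exists (Num.truncn x).+1.
have := truncn_itv (le_trans ler01 x1); rewrite -natr1 => /andP[h1 h2].
by rewrite lerD2r h1 ltW.
Qed.

(** If [x >= 2 * X * sigma], then [i <= 3 / 2 * x] and [j >= x / 2]. Otherwise
    [tau * sigma ^+ 2 <= x] gives [sigma <= 2 * X / tau], which bounds [i] by a constant, and
    [1 <= j] suffices. *)
Lemma quasi_ratio (R : realType) (x i j sigma X tau : R) :
  1 <= sigma -> 0 <= X -> 0 < tau -> tau * sigma ^+ 2 <= x ->
  i <= x + X * sigma -> x - X * sigma <= j -> 1 <= j ->
  i <= (3 + 6 * X ^+ 2 / tau) * j.
Proof.
move=> s1 X0 t0 tx ix xj j1.
have Xt : 0 <= 6 * X ^+ 2 / tau by rewrite divr_ge0 ?mulr_ge0 ?sqr_ge0 // ltW.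
have [h|h] := lerP (2 * (X * sigma)) x; first by nra.
have st : sigma <= 2 * X / tau.
  by rewrite ler_pdivlMr //; nra.
have : 3 * X * sigma <= 6 * X ^+ 2 / tau.
  rewrite (_ : 6 * X ^+ 2 / tau = 3 * X * (2 * X / tau)); last by field; rewrite gt_eqF.
  by rewrite ler_wpM2l // mulr_ge0.
nra.
Qed.

(** * Barriers of bounded area *)

Lemma hop_zone (R : realType) (n : nat) (c : R) (l : nat) (sigma X kp : R) :
  0 < c -> c <= 1 -> 1 <= sigma -> sigma ^+ 2 = l%:R -> (0 < l <= n)%N ->
  0 < kp -> kp <= 1 -> 0 <= X -> kp * sigma ^+ 2 <= hop n c l ->
  let rr := 3 + 6 * X ^+ 2 / kp ^+ 2 in
  forall i j, (0 < i <= n)%N -> (0 < j <= n)%N ->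
    l%:R - X * sigma <= i%:R <= l%:R + X * sigma ->
    l%:R - X * sigma <= j%:R <= l%:R + X * sigma ->
    kp / rr * sigma ^+ 2 <= hop n c i /\ hop n c i <= rr * hop n c j.
Proof.
move=> c0 c1 s1 sl ln k0 k1 X0 Kl rr.
have kp2_gt0 : 0 < kp ^+ 2 by rewrite exprn_gt0.
have rr_ge3 : 3 <= rr by rewrite lerDl divr_ge0 ?mulr_ge0 ?sqr_ge0 // ltW.
have rr0 : 0 < rr by lra.
have s0 : 0 < sigma by lra.
have xl : kp ^+ 2 * sigma ^+ 2 <= l%:R.
  by rewrite -sl ger_pMl ?exprn_gt0 // expr_le1 // ltW.
(* An amplitude of order [l] forces the distance from [l] to the right end to be at least of order
   [l]. Both factors under the root then vary by bounded ratios on the window. *)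
have xr : kp ^+ 2 * sigma ^+ 2 <= n.+1%:R - l%:R.
  have : (kp * sigma ^+ 2) ^+ 2 <= hop n c l ^+ 2.
    by rewrite ler_sqr ?nnegrE ?hop_ge0 // mulr_ge0 ?sqr_ge0 // ltW.
  rewrite hop_sqr; last by lia_nat.
  rewrite -sl => h; rewrite -(ler_pM2l (exprn_gt0 2 s0)).
  have y0 : 0 <= sigma ^+ 2 * (n.+1%:R - sigma ^+ 2).
    by rewrite mulr_ge0 ?sqr_ge0 // sl subr_ge0 ler_nat; lia_nat.
  have c2 : c ^+ 2 <= 1 by rewrite expr_le1 // ltW.
  rewrite [leLHS](_ : _ = (kp * sigma ^+ 2) ^+ 2); last by ring.
  by apply: le_trans h _; exact: ler_piMl.
have ratio i j : (0 < i <= n)%N -> (0 < j <= n)%N ->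
    l%:R - X * sigma <= i%:R <= l%:R + X * sigma ->
    l%:R - X * sigma <= j%:R <= l%:R + X * sigma -> hop n c i <= rr * hop n c j.
  move=> ni nj /andP[li il] /andP[lj jl].
  have ij : i%:R <= rr * j%:R by apply: (quasi_ratio s1 X0 kp2_gt0 xl) => //; rewrite ler1n; lia_nat.
  have ijr : n.+1%:R - i%:R <= rr * (n.+1%:R - j%:R).
    apply: (quasi_ratio s1 X0 kp2_gt0 xr); try lra.
    by have : (j%:R : R) <= n%:R; [rewrite ler_nat; lia_nat | rewrite -(natr1 n); lra].
  rewrite -ler_sqr ?nnegrE ?hop_ge0 //; last by apply: mulr_ge0; [exact: ltW | exact: hop_ge0].
  rewrite [leRHS]exprMn !hop_sqr; try lia_nat.
  rewrite [leRHS](_ : _ = c ^+ 2 * ((rr * j%:R) * (rr * (n.+1%:R - j%:R)))); last by ring.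
  rewrite ler_pM2l ?exprn_gt0 //; apply: ler_pM => //.
  by rewrite subr_ge0 ler_nat; lia_nat.
move=> i j ni nj hi hj; split; last exact: ratio.
have hl : l%:R - X * sigma <= (l%:R : R) <= l%:R + X * sigma.
  have : 0 <= X * sigma by rewrite mulr_ge0 // ltW.
  by move=> ?; apply/andP; split; lra.
have := ratio l i ltac:(lia_nat) ni hl hi; rewrite mulrAC ler_pdivrMr // [leRHS]mulrC.
exact: le_trans Kl.
Qed.

(* In units of [sqrt l], [zone_length] is the size of the window of sites around
   the barrier in which the ground state is controlled by a Harnack inequality;
   there the hopping amplitudes are at least [zone_hop * l] and have mutual
   ratios at most [zone_ratio]. *)
Section Constants.
Variables (R : realType) (kappa kappa0 C L : R).

(** One term for each case of the lower bound on [K l]: the growth of [d] for large [l], the site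
    [l = 1], and bounded [l], where [kappa * sqrt l < 16 * C] and [K l >= kappa0]. *)
Definition near_const := Num.min (kappa / 8) (Num.min kappa0 (kappa0 * kappa ^+ 2 / (256 * C ^+ 2))).
(** Comes from [kappa * (u - l + 1) + 2 * T <= kappa * N / 2] with [u - l <= L * sqrt l] and
    [T = C * sqrt l]; the last 1 leaves room for rounding to an integer. *)
Definition zone_length := 2 * (L + 1 + 2 * C / kappa) + 1.
Definition zone_ratio := 3 + 6 * (L + zone_length) ^+ 2 / near_const ^+ 2.
Definition zone_hop := near_const / zone_ratio.
(** Bounds [(1 + T / kz) ^+ N] for [T = C * sqrt l], [kz = zone_hop * l] and
    [N <= zone_length * sqrt l]; the powers of [l] cancel. *)
Definition harnack_const := expR (C * zone_length / zone_hop).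
(** A mild drop at [l] gives [l - m <= 2 + 4 * T / kappa]; this is that bound divided by
    [N >= sqrt l >= 1]. *)
Definition start_const := 2 + 4 * C / kappa.

Hypothesis kappa_gt0 : 0 < kappa.
Hypothesis kappa_le1 : kappa <= 1.
Hypothesis kappa0_gt0 : 0 < kappa0.
Hypothesis C_gt0 : 0 < C.
Hypothesis L_ge0 : 0 <= L.

Lemma near_const_gt0 : 0 < near_const.
Proof.
rewrite /near_const !lt_min kappa0_gt0 !divr_gt0 //= ?mulr_gt0 ?exprn_gt0 //.
Qed.

Lemma near_const_le1 : near_const <= 1.
Proof. by rewrite /near_const ge_min; apply/orP; left; have := kappa_le1; lra. Qed.

Lemma zone_length_ge1 : 1 <= zone_length.
Proof.
have : 0 < C / kappa by rewrite divr_gt0.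
by rewrite /zone_length -mulrA; have := L_ge0; lra.
Qed.

Lemma zone_ratio_ge1 : 1 <= zone_ratio.
Proof.
have : 0 <= 6 * (L + zone_length) ^+ 2 / near_const ^+ 2.
  by apply: divr_ge0; [apply: mulr_ge0; [|exact: sqr_ge0] | exact: sqr_ge0].
by rewrite /zone_ratio; lra.
Qed.

Lemma zone_hop_gt0 : 0 < zone_hop.
Proof. by rewrite divr_gt0 ?near_const_gt0 // (lt_le_trans ltr01) ?zone_ratio_ge1. Qed.

End Constants.

Section BarrierSolutions.
Variables (R : realType) (n : nat) (c : R) (S U b d phi : nat -> R) (l u : nat).
Variables (kappa kappa0 C L hb delta : R).
Local Notation K := (hop n c).
Hypothesis c_gt0 : 0 < c.
Hypothesis c_le1 : c <= 1.
Hypothesis rt : rates n c S U b d.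
Hypothesis phi_gt0 : forall k, 0 < phi k.
Hypothesis b_phi : forall k, (k <= n)%N -> b k * phi k = K k.+1 * phi k.+1.
Hypothesis d_phi : forall k, (k < n)%N -> d k.+1 * phi k.+1 = K k.+1 * phi k.
Hypothesis U0 : forall k, ~~ (l <= k < u)%N -> U k = 0.
Hypothesis U_le : forall k, U k <= hb.
Hypothesis S_mono : forall k, (k < n)%N -> S k <= S k.+1.
Hypothesis slope : kappa <= 2 * c \/ (forall k, (k < n)%N -> kappa <= `|S k.+1 - S k|).
Hypothesis l_gt0 : (0 < l)%N.
Hypothesis lu : (l < u)%N.
Hypothesis un : (u <= n.+1)%N.
Hypothesis kappa_gt0 : 0 < kappa.
Hypothesis kappa_le1 : kappa <= 1.
Hypothesis kappa0_gt0 : 0 < kappa0.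
Hypothesis C_gt0 : 0 < C.
Hypothesis L_ge0 : 0 <= L.
Hypothesis K1 : kappa0 <= K 1.
Let sigma : R := Num.sqrt l%:R.
Hypothesis hbC : hb * (u%:R - l%:R) <= C * sigma.
Hypothesis uL : u%:R - l%:R <= L * sigma.

Local Notation nearC := (near_const kappa kappa0 C).
Local Notation lengthC := (zone_length kappa C L).
Local Notation ratioC := (zone_ratio kappa kappa0 C L).
Local Notation hopC := (zone_hop kappa kappa0 C L).
Local Notation harnackC := (harnack_const kappa kappa0 C L).
Local Notation startC := (start_const kappa C).

Hypothesis delta_gt0 : 0 < delta.
Hypothesis delta1 : 16 * delta <= kappa.
Hypothesis delta2 : 2 * delta <= kappa0.
Hypothesis delta3 : 3 * delta <= C.
Hypothesis delta4 : delta * (2 * (harnackC ^+ 2 * (startC + 1)) * lengthC ^+ 2) <= hopC.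
Hypothesis delta5 : delta * (2 * (ratioC * harnackC ^+ 2) * (startC + 1)) <= kappa / 2.

Let sigma_sqr : sigma ^+ 2 = l%:R. Proof. by rewrite sqr_sqrtr. Qed.

Let sigma_ge1 : 1 <= sigma.
Proof. by rewrite -sqrtr1 ler_wsqrtr // ler1n. Qed.

Let ln : (l <= n)%N. Proof. lia_nat. Qed.

Let near_gt0 : 0 < nearC. Proof. exact: near_const_gt0. Qed.
Let near_le1 : nearC <= 1. Proof. exact: near_const_le1. Qed.
Let Ck_gt0 : 0 < C / kappa. Proof. by rewrite divr_gt0. Qed.
Let length_ge1 : 1 <= lengthC. Proof. exact: zone_length_ge1. Qed.
Let ratio_ge1 : 1 <= ratioC. Proof. exact: zone_ratio_ge1. Qed.
Let zone_hop_gt0 : 0 < hopC. Proof. exact: zone_hop_gt0. Qed.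

(* If the ground state does not drop steeply across the left end of the
   barrier, then [K l >= d l - 2 C sigma], and [d l] grows linearly in [l]. *)
Let hop_near : d l <= K l + 2 * (C * sigma) -> nearC * sigma ^+ 2 <= K l.
Proof.
move=> near; have d_ge : kappa * (l%:R - 1) / 2 <= d l.
  apply: (@le_trans _ _ (d l.-1)); last first.
    by have := left_d_le c_gt0 rt U0 slope ln (k := l.-1); rewrite prednK //; apply.
  have := left_drift c_gt0 rt U0 slope ln (j := 0) (k := l.-1) ltac:(lia_nat).
  have S_ge k : (k <= n)%N -> S 0 <= S k.
    by elim: k => // k IH kn; apply: le_trans (IH (ltnW kn)) (S_mono kn).
  have := S_ge l.-1 ltac:(lia_nat); have := rates_eq rt (leq0n n).
  have := rates_eq rt (k := l.-1) ltac:(lia_nat); rewrite !U0 ?(rates_d0 rt); try lia_nat.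
  rewrite (_ : l.-1%:R = l%:R - 1 :> R); last by rewrite -subn1 natrB.
  by lra.
have Kl : kappa0 <= K l by apply: le_trans K1 (hop1_le _ _); rewrite // l_gt0.
have [l1|l2] := leqP l 1.
  rewrite sigma_sqr (_ : l = 1%N) ?mulr1; last by lia_nat.
  by apply: le_trans K1; rewrite /near_const !ge_min lexx orbT.
have {}l2 : 2 <= sigma ^+ 2 by rewrite sigma_sqr ler_nat.
rewrite -sigma_sqr in d_ge.
have [big|small] := lerP (16 * C) (kappa * sigma).
  apply: (@le_trans _ _ (kappa / 8 * sigma ^+ 2)).
    by rewrite ler_wpM2r ?sqr_ge0 // /near_const ge_min lexx.
  have h1 : 16 * C * sigma <= kappa * sigma * sigma by apply: ler_wpM2r => //; exact: le_trans sigma_ge1.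
  have h2 : kappa * 2 <= kappa * sigma ^+ 2 by rewrite ler_pM2l.
  by lra.
apply: le_trans _ Kl.
apply: (@le_trans _ _ (kappa0 * kappa ^+ 2 / (256 * C ^+ 2) * sigma ^+ 2)).
  by rewrite ler_wpM2r ?sqr_ge0 // /near_const !ge_min lexx !orbT.
rewrite mulrAC ler_pdivrMr ?mulr_gt0 ?exprn_gt0 // -mulrA ler_pM2l //.
have ks0 : 0 <= kappa * sigma by apply: mulr_ge0; [exact: ltW | exact: le_trans sigma_ge1].
rewrite -exprMn (_ : 256 * C ^+ 2 = (16 * C) ^+ 2); last by ring.
by rewrite ler_sqr ?nnegrE //; [exact: ltW | exact: le_trans (ltW small)].
Qed.

Let T := C * sigma.

Let U_sum i j : \sum_(i <= k < j) U k <= T.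
Proof.
apply: le_trans hbC; apply: sum_barrier_le U0 _ U_le _ _; first exact: ltnW.
exact: rates_U_ge0 rt.
Qed.

Let zone_exists : exists N : nat, [/\ (0 < N)%N, (lengthC - 1) * sigma <= N%:R,
  N%:R <= lengthC * sigma & sigma <= N%:R].
Proof.
have s1 := sigma_ge1; have k1 := Ck_gt0; have L0 := L_ge0.
have z1 : 2 <= lengthC - 1 by rewrite /zone_length addrK -mulrA; lra.
have x1 : 1 <= (lengthC - 1) * sigma by nra.
have [N /andP[N1 N2]] := nat_between x1; exists N.
have sN : sigma <= N%:R by apply: le_trans N1; nra.
split => //; last by lra.
by rewrite -(ltr0n R); lra.
Qed.

Lemma barrier_solutions : exists m G G', [/\ (m <= n)%N, right_solution n b d delta m G &
  right_solution n (fun k => d (n - k)%N) (fun k => b (n - k)%N) delta (n - m) G'].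
Proof.
have [m fm] := first_max_exists n c b; have [mn bm bm'] := fm.
have [N [N_gt0 N_ge N_le sN]] := zone_exists.
have s1 := sigma_ge1; have k1 := Ck_gt0; have L0 := L_ge0; have zl := length_ge1.
have s0 : 0 < sigma by lra.
have T0 : 0 < T by rewrite mulr_gt0.
have kz0 : 0 < hopC * sigma ^+ 2 by rewrite mulr_gt0 ?exprn_gt0.
have CkE : kappa * (C / kappa) = C by rewrite mulrC divfK // gt_eqF.
have A_ge : 2 * kappa + 4 * T <= kappa * startC * N%:R.
  have -> : kappa * startC = 2 * kappa + 4 * C by rewrite /start_const; field; rewrite gt_eqF.
  have h1 : kappa * 1 <= kappa * N%:R by rewrite ler_pM2l //; lra.
  have h2 : C * sigma <= C * N%:R by rewrite ler_pM2l.
  by rewrite /T; lra.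
have A_ge0 : 0 <= startC by rewrite /start_const -mulrA; lra.
have NgeR : kappa * (u%:R - l%:R + 1) + 2 * T <= kappa * N%:R / 2.
  have h1 : kappa * (u%:R - l%:R) <= kappa * (L * sigma) by rewrite ler_pM2l.
  have h2 : kappa * 1 <= kappa * sigma by rewrite ler_pM2l.
  have h3 : kappa * ((lengthC - 1) * sigma) <= kappa * N%:R by rewrite ler_pM2l.
  have h4 : kappa * ((lengthC - 1) * sigma) = 2 * (kappa * (L * sigma) + kappa * sigma + 2 * (C * sigma)).
    by rewrite /zone_length; field; rewrite gt_eqF.
  by rewrite /T; lra.
have H_ge : (1 + T / (hopC * sigma ^+ 2)) ^+ N <= harnackC.
  apply: (@le_trans _ _ (expR (N%:R * (T / (hopC * sigma ^+ 2))))).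
    rewrite expRM_natl lerXn2r ?nnegrE ?expR_ge0 ?expR_ge1Dx //.
    by rewrite addr_ge0 // divr_ge0 // ltW.
  rewrite ler_expR (_ : _ * _ = C * (N%:R / sigma) / hopC); last first.
    by rewrite /T; field; rewrite !gt_eqF.
  rewrite ler_pM2r ?invr_gt0 // ler_pM2l // ler_pdivrMr //.
have dT : 3 * delta <= T by apply: le_trans delta3 _; rewrite ler_peMr // ltW.
have dz : delta * (2 * N%:R * (harnackC ^+ 2 * ((startC + 1) * N%:R))) <= hopC * sigma ^+ 2.
  have NN : N%:R ^+ 2 <= (lengthC * sigma) ^+ 2.
    by rewrite lerXn2r ?nnegrE // mulr_ge0 // ltW // (lt_le_trans ltr01).
  pose X := delta * (2 * (harnackC ^+ 2 * (startC + 1))).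
  have d4 : X * lengthC ^+ 2 <= hopC by rewrite -mulrA; exact: delta4.
  have X0 : 0 <= X.
    apply: mulr_ge0; first exact: ltW.
    by apply: mulr_ge0 => //; apply: mulr_ge0; [exact: sqr_ge0 | exact: addr_ge0].
  apply: (@le_trans _ _ (X * lengthC ^+ 2 * sigma ^+ 2)); last first.
    by rewrite ler_pM2r ?exprn_gt0.
  rewrite [leLHS](_ : _ = X * N%:R ^+ 2); last by rewrite /X; ring.
  by rewrite -mulrA -exprMn ler_wpM2l.
(* The window reaches [N] sites beyond both ends of the barrier, so it also contains the zone of the
   reflected problem. *)
have zone : nearC * sigma ^+ 2 <= K l -> forall i j, (0 < i <= n)%N -> (0 < j <= n)%N ->
    (l - N <= i <= u + N)%N -> (l - N <= j <= u + N)%N ->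
    hopC * sigma ^+ 2 <= K i /\ K i <= ratioC * K j.
  move=> Kl i j ni nj iN jN.
  have X0 : 0 <= L + lengthC by lra.
  have ul : (u%:R : R) <= l%:R + L * sigma by have := uL; lra.
  have bnd k : (l - N <= k <= u + N)%N ->
      l%:R - (L + lengthC) * sigma <= (k%:R : R) <= l%:R + (L + lengthC) * sigma.
    move=> /andP[k1' k2'].
    have : (l%:R : R) <= k%:R + N%:R by rewrite -natrD ler_nat; lia_nat.
    have : (k%:R : R) <= u%:R + N%:R by rewrite -natrD ler_nat; lia_nat.
    have : 0 <= L * sigma by rewrite mulr_ge0 // ltW.
    by move=> h1 h2 h3; apply/andP; split; lra.
  apply: (hop_zone (X := L + lengthC) c_gt0 c_le1 s1 sigma_sqr) => //; try exact: bnd.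
  by rewrite l_gt0.
have K_ge k : (0 < k <= n)%N -> kappa0 <= K k.
  by move=> kn; apply: le_trans K1 _; apply: hop1_le.
have [G rG] : exists G, right_solution n b d delta m G.
  apply: (@right_solution_exists R n c S U b d phi l u m N kappa kappa0 T (hopC * sigma ^+ 2)
    ratioC harnackC startC delta) => //; try lia_nat.
  - move=> mu near i j iN jN ni nj; apply: zone => //; try lia_nat.
    (* If the barrier starts no later than [m], [phi] still rises into [l], so [d l < K l]. *)
    apply: hop_near; case: near => [lm|]; last by rewrite -/T; lra.
    have := first_max_d c_gt0 rt fm (k := l.-1); rewrite prednK // => /(_ ltac:(lia_nat)).
    by rewrite -/T; lra.
have [G' rG'] : exists G', right_solution n (fun k => d (n - k)%N) (fun k => b (n - k)%N) delta (n - m) G'.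
  apply: (@right_solution_exists R n c (fun k => S (n - k)%N) (fun k => U (n - k)%N)
    (fun k => d (n - k)%N) (fun k => b (n - k)%N) (fun k => phi (n - k)%N)
    (n.+1 - u) (n.+1 - l) (n - m) N kappa kappa0 T (hopC * sigma ^+ 2)
    ratioC harnackC startC delta) => //; try lia_nat.
  - exact: rates_rev.
  - exact: (reflect_d_phi rt d_phi).
  - exact: (reflect_b_phi b_phi).
  - by move=> k kn; apply: U0; lia_nat.
  - exact: reflect_slope.
  - move=> i j; apply: le_trans (_ : hb * ((n.+1 - l)%:R - (n.+1 - u)%:R) <= _).
      apply: sum_barrier_le; [lia_nat | | |] => k.
      + by move=> kn; apply: U0; lia_nat.
      + exact: rates_U_ge0 rt _.
      + exact: U_le.
    rewrite !natrB ?(leqW ln) // (_ : _ - _ - _ = u%:R - l%:R); last by ring.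
    exact: hbC.
  - exact: (first_max_rev c_gt0 rt fm).
  - by rewrite !natrB ?(leqW ln) //; move: NgeR; lra.
  (* In the mirror image [mu] says that the barrier starts before [m], so [phi] still rises into the
     true left end [l]; [sqrt l] remains the scale for both sides. *)
  - move=> mu _ i j iN jN ni nj.
    have lm : (l < m)%N by lia_nat.
    have Kl : nearC * sigma ^+ 2 <= K l.
      apply: hop_near; have := first_max_d c_gt0 rt fm (k := l.-1).
      by rewrite prednK // => /(_ ltac:(lia_nat)); move: T0; rewrite /T; lra.
    rewrite -(@hop_rev _ n c i) ?(leqW _) //; last by lia_nat.
    rewrite -(@hop_rev _ n c j) ?(leqW _) //; last by lia_nat.
    by apply: zone => //; lia_nat.
by exists m, G, G'.
Qed.

End BarrierSolutions.

(** * The Hamiltonian *)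

Section Hamiltonian.
Variables (R : realType) (n : nat) (a k0 c0 s : R) (h : 'I_n.+1 -> R).
Hypothesis n_gt0 : (0 < n)%N.
Hypothesis c0_gt0 : 0 < c0.
Hypothesis c0_a : c0 <= a.
Hypothesis k0_le0 : k0 <= 0.
Hypothesis s_ge0 : 0 <= s.
Hypothesis s_lt1 : s < 1.
Hypothesis h_ge0 : forall k, 0 <= h k.
Local Notation H := (Hqs a k0 h s).
Local Notation c := (1 - s).
Local Notation K := (hop n c).
Local Notation e := (spectrum H)`_0.

Definition quad (k : nat) : R := s * (a * (k%:R - k0) ^+ 2).
Definition barrier (k : nat) : R := if (k <= n)%N then s * h (inord k) else 0.

Let c_gt0 : 0 < c. Proof. by rewrite subr_gt0. Qed.
Let c_le1 : c <= 1. Proof. by rewrite gerBl. Qed.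

Lemma Hqs_entries (i j : 'I_n.+1) : H i j =
  (quad i + barrier i) *+ (i == j) - K j *+ (i.+1 == j :> nat) - K i *+ (i == j.+1 :> nat).
Proof.
rewrite !mxE /quad /barrier -ltnS ltn_ord inord_val /hop (eq_sym (i.+1)).
have [->|ij] := eqVneq i j.
  by rewrite ltn_eqF // !mulr1n !mulr0n mulr0 oppr0 /Vq; ring.
rewrite !mulr0n addr0 mulr0 addr0 sub0r.
have [ji|ji] := eqVneq (j : nat) i.+1.
  rewrite (_ : (i == j.+1 :> nat) = false) ?mulr0n ?subr0 ?mulr1n //.
  by rewrite ji; apply/negbTE; rewrite neq_ltn; apply/orP; left; exact: leqnSn.
by rewrite mulr0n oppr0 sub0r; case: eqP => _; rewrite ?mulr1n ?mulr0n ?mulr0.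
Qed.

Let quad_step k : quad k.+1 - quad k = s * a * (2 * k%:R + 1 - 2 * k0).
Proof. by rewrite /quad -(natr1 k); ring. Qed.

Let quad_step_ge k : s * c0 <= quad k.+1 - quad k.
Proof.
rewrite quad_step -mulrA ler_wpM2l //.
have a0 : 0 < a by exact: lt_le_trans c0_a.
apply: le_trans c0_a _; rewrite ler_peMr ?(ltW a0) //.
by have := ler0n R k; have := k0_le0; lra.
Qed.

Let quad_mono k : quad k <= quad k.+1.
Proof.
rewrite -subr_ge0; apply: le_trans (quad_step_ge k).
by rewrite mulr_ge0 // ltW.
Qed.

Let quad_convex k : quad k.+1 - quad k <= quad k.+2 - quad k.+1.
Proof.
rewrite !quad_step -(natr1 k); apply: ler_wpM2l; last lra.
by rewrite mulr_ge0 //; exact: le_trans (ltW c0_gt0) c0_a.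
Qed.

(** For [s <= 1 / 2], [2 * (1 - s) >= 1]; for larger [s] the potential rises by at least [c0 / 2]
    per site. *)
Definition kappa_const := Num.min 1 (c0 / 2).
(** The first term bounds [K 1] from below for [s <= 1 / 2], so a smaller [K 1] means a strong
    potential. The second makes eight times the constant at most the slope [c0 / 2] used for weak
    hopping. *)
Definition kappa0_const := Num.min (1 / 2) (c0 / 16).

Lemma kappa_slope (S : nat -> R) : (forall k, S k.+1 - S k = quad k.+1 - quad k) ->
  kappa_const <= 2 * c \/ (forall k, (k < n)%N -> kappa_const <= `|S k.+1 - S k|).
Proof.
move=> SE; have [s2|s2] := lerP s (1 / 2).
  by left; rewrite /kappa_const ge_min; apply/orP; left; lra.
right => k _; rewrite SE; apply: le_trans (ler_norm _); apply: le_trans (quad_step_ge k).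
by rewrite /kappa_const ge_min; apply/orP; right; have := c0_gt0; nra.
Qed.

Lemma hop1_small : K 1 < kappa0_const -> 1 / 2 < s.
Proof.
rewrite ltNge => K1; rewrite ltNge; apply: contra K1 => s2.
apply: (@le_trans _ _ (1 / 2)); first by rewrite /kappa0_const ge_min lexx.
rewrite /hop; apply: (@le_trans _ _ (c * 1)); first lra.
rewrite ler_pM2l // mul1r -natr1 addrK -[leLHS]sqrtr1 ler_wsqrtr // ler1n //.
Qed.

Section GroundState.
Variable (phi : nat -> R).
Hypothesis phi_gt0 : forall k, 0 < phi k.
Hypothesis phiE : forall k, (k <= n)%N ->
  (quad k + barrier k) * phi k - K k * phi k.-1 - K k.+1 * phi k.+1 = e * phi k.
Local Notation b := (ground_b n c phi).
Local Notation d := (ground_d n c phi).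
Local Notation S := (fun k => quad k - e).

Let barrier_ge0 k : 0 <= barrier k.
Proof. by rewrite /barrier; case: ifP => // _; rewrite mulr_ge0. Qed.

Lemma Hqs_rates : rates n c S barrier b d.
Proof.
apply: (ground_rates c_gt0 phi_gt0 phiE) => [k|//|k _]; first by ring.
by have := quad_convex k; rewrite !opprB !addrA !subrK.
Qed.

Lemma Hqs_dirichlet (delta : R) (m : nat) (G G' : nat -> R) : (m <= n)%N ->
  right_solution n b d delta m G ->
  right_solution n (fun k => d (n - k)%N) (fun k => b (n - k)%N) delta (n - m) G' ->
  forall v : 'rV[R]_n.+1, v 0 (inord m) = 0 -> (e + delta) * \sum_i v 0 i ^+ 2 <= qform H v.
Proof.
exact: (dirichlet_ge c_gt0 (Hqs_sym _ _ _ _) Hqs_entries phi_gt0 phiE).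
Qed.

Lemma small_hop_dirichlet (delta : R) : K 1 < kappa0_const -> h ord0 = 0 ->
  0 < delta -> 2 * delta <= kappa0_const ->
  forall v : 'rV[R]_n.+1, v 0 (inord 0) = 0 -> (e + delta) * \sum_i v 0 i ^+ 2 <= qform H v.
Proof.
move=> K1 h0 d0 d1; have rt := Hqs_rates.
have k0c : kappa0_const <= c0 / 16 by rewrite /kappa0_const ge_min lexx orbT.
apply: (@Hqs_dirichlet delta 0 (ramp R 0) (ramp R (n - 0))) => //.
  apply: (small_hop_solution c_gt0 rt (nu := c0 / 2) (kappa0 := kappa0_const)) => //.
  - move=> k _; have := quad_step_ge k; have := hop1_small K1; have := c0_gt0; nra.
  - by rewrite /barrier /= (_ : inord 0 = ord0) ?h0 ?mulr0 //; apply: val_inj; rewrite /= inordK.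
  - lra.
  - exact: ltW.
  - lra.
by apply: ramp_right_solution => [|k]; rewrite subn0; [rewrite ltnn | lia_nat].
Qed.

Lemma free_dirichlet (delta : R) : kappa0_const <= K 1 -> (forall k, h k = 0) ->
  0 < delta -> 16 * delta <= kappa_const -> 2 * delta <= kappa0_const ->
  exists m, forall v : 'rV[R]_n.+1, v 0 (inord m) = 0 ->
    (e + delta) * \sum_i v 0 i ^+ 2 <= qform H v.
Proof.
move=> K1 h0 d0 d1 d2; have rt := Hqs_rates.
have b0 k : barrier k = 0 by rewrite /barrier h0 mulr0; case: ifP.
have [m fm] := first_max_exists n c b; have [mn bm _] := fm.
have kap0 : 0 < kappa_const by rewrite /kappa_const lt_min ltr01 divr_gt0.
have [G rG] : exists G, right_solution n b d delta m G.
  apply: (free_right_solution c_gt0 rt (phi := phi) (kappa := kappa_const) (kappa0 := kappa0_const)) => //.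
  - by move=> k _; exact: ground_b_phi.
  - by move=> k _; exact: ground_d_phi.
  - by apply: kappa_slope => k; ring.
have [G' rG'] : exists G', right_solution n (fun k => d (n - k)%N) (fun k => b (n - k)%N) delta (n - m) G'.
  apply: (free_right_solution c_gt0 (rates_rev rt) (phi := fun k => phi (n - k)%N)
    (kappa := kappa_const) (kappa0 := kappa0_const)) => //.
  - exact: (reflect_d_phi rt (fun k _ => ground_d_phi n c phi_gt0 k)).
  - exact: (reflect_b_phi (fun k _ => ground_b_phi n c phi_gt0 k)).
  - by apply: (reflect_slope (S := S)); apply: kappa_slope => k; ring.
  - by rewrite leq_subr.
  - exact: (first_max_rev c_gt0 rt fm).
by exists m; exact: (Hqs_dirichlet mn rG rG').
Qed.

Lemma barrier_dirichlet (l u : nat) (C L hb delta : R) :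
  kappa0_const <= K 1 -> (1 <= l)%N -> (l < u)%N -> (u <= n.+1)%N ->
  (forall k : 'I_n.+1, h k != 0 -> (l <= k < u)%N) ->
  0 <= hb -> (forall k, h k <= hb) ->
  hb * (u%:R - l%:R) <= C * Num.sqrt l%:R -> u%:R - l%:R <= L * Num.sqrt l%:R ->
  0 < C -> 0 <= L -> 0 < delta ->
  16 * delta <= kappa_const -> 2 * delta <= kappa0_const -> 3 * delta <= C ->
  delta * (2 * (harnack_const kappa_const kappa0_const C L ^+ 2 *
    (start_const kappa_const C + 1)) * zone_length kappa_const C L ^+ 2)
    <= zone_hop kappa_const kappa0_const C L ->
  delta * (2 * (zone_ratio kappa_const kappa0_const C L *
    harnack_const kappa_const kappa0_const C L ^+ 2) * (start_const kappa_const C + 1))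
    <= kappa_const / 2 ->
  exists m, forall v : 'rV[R]_n.+1, v 0 (inord m) = 0 ->
    (e + delta) * \sum_i v 0 i ^+ 2 <= qform H v.
Proof.
move=> K1 l0 lu un supp hb0 h_le hbC uL C0 L0 d0 d1 d2 d3 d4 d5; have rt := Hqs_rates.
have kap0 : 0 < kappa_const by rewrite /kappa_const lt_min ltr01 divr_gt0.
have [] := barrier_solutions c_gt0 c_le1 rt phi_gt0 (l := l) (u := u)
  (kappa := kappa_const) (kappa0 := kappa0_const) (C := C) (L := L) (hb := hb) (delta := delta) => //.
- by move=> k _; exact: ground_b_phi.
- by move=> k _; exact: ground_d_phi.
- move=> k kn; rewrite /barrier; case: leqP => // kn'.
  have [->|/supp] := eqVneq (h (inord k)) 0; first by rewrite mulr0.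
  by rewrite inordK // (negPf kn).
- move=> k; rewrite /barrier; case: ifP => // _.
  apply: le_trans (h_le (inord k)); exact: ler_piMl (h_ge0 _) (ltW s_lt1).
- by move=> k _; rewrite lerD2r quad_mono.
- by apply: kappa_slope => k; ring.
- by rewrite /kappa_const ge_min lexx.
- by rewrite /kappa0_const lt_min !divr_gt0.
by move=> m [G [G' [mn rG rG']]]; exists m; exact: (Hqs_dirichlet mn rG rG').
Qed.

End GroundState.

End Hamiltonian.

(** * From Dirichlet bounds to the spectral gap *)

Lemma spectral_gap_ge (R : realType) (n : nat) (A : 'M[R]_n.+1) (m : nat) (delta : R) :
  A^T = A -> (0 < n)%N ->
  (forall v : 'rV[R]_n.+1, v 0 (inord m) = 0 ->
    ((spectrum A)`_0 + delta) * \sum_i v 0 i ^+ 2 <= qform A v) ->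
  delta <= spectral_gap A.
Proof.
move=> A_sym n0 Aq; rewrite /spectral_gap lerBrDl.
exact: (spectrum1_ge A_sym (m := inord m)).
Qed.

Lemma qform_Hqs (R : realType) (n : nat) (a k0 s : R) (h : 'I_n.+1 -> R) (v : 'rV[R]_n.+1) :
  qform (Hqs a k0 h s) v =
  qform (Hqs a k0 (fun _ : 'I_n.+1 => 0) s) v + s * \sum_i h i * v 0 i ^+ 2.
Proof.
rewrite !qformE mulr_sumr -big_split /=; apply: eq_bigr => j _.
transitivity (\sum_i (v 0 i * Hqs a k0 (fun _ : 'I_n.+1 => 0) s i j * v 0 j +
    (v 0 i * (s * h i) * v 0 j) *+ (i == j))).
  apply: eq_bigr => i _; rewrite !mxE.
  by case: eqVneq => _; rewrite ?mulr1n ?mulr0n; ring.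
rewrite big_split /=; congr (_ + _); rewrite (bigD1 j) //= eqxx mulr1n big1 => [|i /negPf->].
  by rewrite addr0; ring.
by rewrite mulr0n.
Qed.

(** A nonnegative barrier can only raise the form on vectors vanishing at [m], and it raises the
    lowest eigenvalue by at most [hb], as testing with the ground state of the free matrix shows. *)
Lemma gap_perturbation (R : realType) (n : nat) (a k0 s hb delta : R) (h : 'I_n.+1 -> R) (m : nat) :
  (0 < n)%N -> 0 <= s -> s <= 1 -> (forall k, 0 <= h k) -> (forall k, h k <= hb) ->
  (forall v : 'rV[R]_n.+1, v 0 (inord m) = 0 ->
    ((spectrum (Hqs a k0 (fun _ : 'I_n.+1 => 0) s))`_0 + delta) * \sum_i v 0 i ^+ 2
      <= qform (Hqs a k0 (fun _ : 'I_n.+1 => 0) s) v) ->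
  delta - hb <= spectral_gap (Hqs a k0 h s).
Proof.
have shift (x y : R) : x <= y + hb -> x + (delta - hb) <= y + delta by lra.
move=> n0 s0 s1 h0 hle H0q; set H0 := Hqs a k0 (fun _ : 'I_n.+1 => 0) s in H0q.
have hs (v : 'rV[R]_n.+1) : 0 <= s * \sum_i h i * v 0 i ^+ 2 <= hb * \sum_i v 0 i ^+ 2.
  rewrite mulr_ge0 ?sumr_ge0 //= => [|i _]; last by rewrite mulr_ge0 ?sqr_ge0.
  rewrite !mulr_sumr; apply: ler_sum => i _; rewrite mulrA ler_wpM2r ?sqr_ge0 //.
  by apply: le_trans (hle i); exact: ler_piMl.
have [w w0 wE] := spectrum0_eigen (Hqs_sym a k0 (fun _ : 'I_n.+1 => 0) s) (ltn0Sn n).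
have wq : qform H0 w = (spectrum H0)`_0 * \sum_i w 0 i ^+ 2.
  rewrite /qform wE -scalemxAl mxE mxE; congr (_ * _); apply: eq_bigr => i _.
  by rewrite !mxE -expr2.
have w_gt0 : 0 < \sum_i w 0 i ^+ 2.
  rewrite lt0r sumr_ge0 ?andbT => [|i _]; last exact: sqr_ge0.
  apply: contraNneq w0; move/eqP; rewrite psumr_eq0 => [/allP w_eq0|i _]; last exact: sqr_ge0.
  apply/eqP/rowP => i; rewrite mxE; apply/eqP; rewrite -sqrf_eq0.
  by apply: w_eq0; rewrite mem_index_enum.
have e_le : (spectrum (Hqs a k0 h s))`_0 <= (spectrum H0)`_0 + hb.
  rewrite -(ler_pM2r w_gt0); apply: le_trans (spectrum0_le (Hqs_sym _ _ _ _) w) _.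
  by rewrite qform_Hqs wq mulrDl lerD2l; have /andP[] := hs w.
apply: (@spectral_gap_ge _ _ _ m) => // [|v vm]; first exact: Hqs_sym.
rewrite qform_Hqs; have /andP[p0 _] := hs v.
apply: le_trans (_ : ((spectrum H0)`_0 + delta) * \sum_i v 0 i ^+ 2 <= _).
  apply: ler_wpM2r; first by apply: sumr_ge0 => i _; exact: sqr_ge0.
  exact: shift.
by apply: le_trans (H0q v vm) _; rewrite lerDl.
Qed.

(** The matrix is diagonal. As [k0 <= 0], the potential at any other site exceeds its value at 0 by
    at least [a], and the barrier vanishes at 0. *)
Lemma gap_at_one (R : realType) (n : nat) (a k0 c0 : R) (h : 'I_n.+1 -> R) :
  (0 < n)%N -> 0 < c0 -> c0 <= a -> k0 <= 0 -> (forall k, 0 <= h k) -> h ord0 = 0 ->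
  c0 <= spectral_gap (Hqs a k0 h 1).
Proof.
move=> n0 c0_gt0 c0a k00 h0 h00; set A := Hqs a k0 h 1.
pose W (i : 'I_n.+1) := Vq a k0 i + h i.
have AE i j : A i j = W i *+ (i == j).
  by rewrite !mxE /W; case: eqVneq => _; rewrite ?mulr1n ?mulr0n; ring.
have A_sym : A^T = A by exact: Hqs_sym.
have row (w : 'rV[R]_n.+1) i : (w *m A) 0 i = w 0 i * W i.
  rewrite mxE (bigD1 i) //= AE eqxx mulr1n big1 ?addr0 // => j ji.
  by rewrite AE (negPf ji) mulr0n mulr0.
have e_le : (spectrum A)`_0 <= W ord0.
  have qW : qform A (delta_mx 0 ord0) = W ord0.
    by rewrite /qform trmx_delta -rowE -colE [LHS]mxE [LHS]mxE AE eqxx mulr1n.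
  have := spectrum0_le A_sym (delta_mx 0 ord0); rewrite qW (bigD1 ord0) //= big1 => [|i i0].
    by rewrite mxE !eqxx expr1n addr0 mulr1.
  by rewrite mxE (negPf i0) expr0n.
apply: (@spectral_gap_ge _ _ _ 0) => // v vm.
pose w : 'rV[R]_n.+1 := \row_i (i != inord 0)%:R.
apply: (qform_ge_supersolution A_sym (m := inord 0) (w := w)) => //.
- by move=> i j ij; rewrite AE (negPf ij).
- by rewrite mxE eqxx.
- by move=> i i0; rewrite mxE i0 ltr01.
move=> i i0; rewrite row !mxE i0 mulr1 mul1r; apply: le_trans (_ : W ord0 + c0 <= _).
  by rewrite lerD2r.
have i1 : 1 <= ((i : nat)%:R : R).
  rewrite ler1n lt0n; apply: contraNneq i0 => i0; apply/eqP/val_inj.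
  by rewrite /= inordK.
rewrite /W /Vq h00 addr0 /=; have := h0 i.
have a0 : 0 < a by exact: lt_le_trans c0a.
suff : a * (0%:R - k0) ^+ 2 + a * 1 <= a * (i%:R - k0) ^+ 2 by lra.
by rewrite -mulrDr ler_pM2l //; nra.
Qed.

Lemma mul_le_of_le_div (R : realFieldType) (delta D z : R) :
  0 < delta -> 0 < z -> delta <= z / (1 + `|D|) -> delta * D <= z.
Proof.
move=> d0 z0; rewrite ler_pdivlMr ?ltr_wpDr //; apply: le_trans.
by rewrite ler_pM2l //; have := ler_norm D; lra.
Qed.

Lemma pos_lower_bound (R : realDomainType) (x y z w : R) :
  0 < x -> 0 < y -> 0 < z -> 0 < w ->
  exists2 d, 0 < d & [/\ d <= x, d <= y, d <= z & d <= w].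
Proof.
move=> x0 y0 z0 w0; exists (Num.min (Num.min x y) (Num.min z w)).
  by rewrite !lt_min x0 y0 z0.
by split; rewrite !ge_min lexx ?orbT.
Qed.

Theorem theorem8 (R : realType) :
  forall c0 C : R, 0 < c0 -> 0 < C ->
  exists delta : R, 0 < delta /\
  forall (n : nat), (1 <= n)%N ->
  forall (a k0 : R), c0 <= a -> k0 <= 0 ->
  forall (l u : nat), (1 <= l)%N -> (u <= n.+1)%N ->
  forall (h : 'I_n.+1 -> R) (hbar : R),
    (forall k, 0 <= h k) ->
    (forall k : 'I_n.+1, h k != 0 -> (l <= k < u)%N) ->
    (forall k, h k <= hbar) ->
    hbar * ((u%:R - l%:R) / Num.sqrt l%:R) <= C ->
  forall s : R, 0 <= s <= 1 ->
    delta <= spectral_gap (Hqs a k0 h s).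
Proof.
move=> c0 C c0_gt0 C_gt0.
pose kap := kappa_const c0; pose kap0 := kappa0_const c0.
have kap_gt0 : 0 < kap by rewrite lt_min ltr01 divr_gt0.
have kap_le1 : kap <= 1 by rewrite ge_min lexx.
have kap0_gt0 : 0 < kap0 by rewrite lt_min !divr_gt0.
pose d1 := Num.min (kap / 16) (kap0 / 2).
have d1_gt0 : 0 < d1 by rewrite lt_min !divr_gt0.
have d1_kap : 16 * d1 <= kap.
  by rewrite -ler_pdivlMl // mulrC ge_min lexx.
have d1_kap0 : 2 * d1 <= kap0.
  by rewrite -ler_pdivlMl // mulrC ge_min lexx orbT.
(* A barrier higher than [d1 / 2] whose area is at most [C * sqrt l] has length at most
   [L * sqrt l]. *)
pose L := 2 * C / d1.
have L_ge0 : 0 <= L by rewrite divr_ge0 ?mulr_ge0 // ltW.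
pose z := zone_hop kap kap0 C L.
have z_gt0 : 0 < z by exact: zone_hop_gt0.
pose D1 := 2 * (harnack_const kap kap0 C L ^+ 2 * (start_const kap C + 1)) * zone_length kap C L ^+ 2.
pose D2 := 2 * (zone_ratio kap kap0 C L * harnack_const kap kap0 C L ^+ 2) * (start_const kap C + 1).
pose x1 := z / (1 + `|D1|); pose x2 := kap / 2 / (1 + `|D2|).
have [d2 d2_gt0 [d2_d1 d2_C d2_x1 d2_x2]] :
    exists2 d, 0 < d & [/\ d <= d1, d <= C / 3, d <= x1 & d <= x2].
  have pos (y D : R) : 0 < y -> 0 < y / (1 + `|D|) by move=> y0; rewrite divr_gt0 // ltr_wpDr.
  by apply: pos_lower_bound; [|apply: divr_gt0 | apply: pos | apply: pos; apply: divr_gt0].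
(* Half of [d1], because a low barrier may cost the other half; [c0] is the gap at [s = 1]. *)
have [delta delta_gt0 [dl1 dl2 dl3 _]] :
    exists2 d, 0 < d & [/\ d <= d1 / 2, d <= d2, d <= c0 & d <= c0].
  by apply: pos_lower_bound; rewrite // divr_gt0.
exists delta; split=> //.
move=> n n_gt0 a k0 c0a k00 l u l_gt0 un h hbar h_ge0 supp h_le hC s /andP[s0 s1].
have h00 : h ord0 = 0.
  by have [//|/supp] := eqVneq (h ord0) 0; rewrite leqNgt l_gt0.
have hbar0 : 0 <= hbar by exact: le_trans (h_ge0 ord0) (h_le ord0).
have [->|s_neq1] := eqVneq s 1; first by apply: le_trans dl3 _; exact: gap_at_one.
have s_lt1 : s < 1 by rewrite lt_neqAle s_neq1.
have c_gt0 : 0 < 1 - s by rewrite subr_gt0.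
have ground (g : 'I_n.+1 -> R) := ground_state c_gt0 (Hqs_sym a k0 g s)
  (W := fun k => quad a k0 s k + barrier s g k) (Hqs_entries a k0 s g).
have [K1|K1] := ltrP (hop n (1 - s) 1) kap0.
  have [phi [phi_gt0 phiE]] := ground h.
  apply: le_trans (_ : d1 <= _); first by apply: le_trans dl1 _; lra.
  apply: (spectral_gap_ge (Hqs_sym _ _ _ _) n_gt0 (m := 0)).
  exact: (small_hop_dirichlet n_gt0 c0_gt0 c0a k00 s0 s_lt1 h_ge0 phi_gt0 phiE).
have free (g : 'I_n.+1 -> R) : (forall k, g k = 0) ->
  exists m, forall v : 'rV[R]_n.+1, v 0 (inord m) = 0 ->
    ((spectrum (Hqs a k0 g s))`_0 + d1) * \sum_i v 0 i ^+ 2 <= qform (Hqs a k0 g s) v.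
  move=> g0; have [phi [phi_gt0 phiE]] := ground g.
  have g_ge0 k : 0 <= g k by rewrite g0.
  exact: (free_dirichlet n_gt0 c0_gt0 c0a k00 s0 s_lt1 g_ge0 phi_gt0 phiE).
have [hb_le|hb_gt] := lerP hbar (d1 / 2).
  have [m fm] := free (fun _ => 0) (fun _ => erefl).
  apply: le_trans (gap_perturbation n_gt0 s0 s1 h_ge0 h_le fm).
  by apply: le_trans dl1 _; rewrite lerBrDr; lra.
have [ul|lu] := leqP u l.
  have h0 k : h k = 0.
    have [//|/supp/andP[lk ku]] := eqVneq (h k) 0.
    by have := leq_trans ku (leq_trans ul lk); rewrite ltnn.
  have [m fm] := free h h0; apply: le_trans (spectral_gap_ge (Hqs_sym _ _ _ _) n_gt0 fm).
  by apply: le_trans dl1 _; lra.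
have sl : 0 < Num.sqrt (l%:R : R) by rewrite sqrtr_gt0 ltr0n.
have hbC : hbar * (u%:R - l%:R) <= C * Num.sqrt l%:R by rewrite -ler_pdivrMr // -mulrA.
have uL : u%:R - l%:R <= L * Num.sqrt l%:R.
  have ul0 : 0 <= u%:R - l%:R :> R by rewrite subr_ge0 ler_nat ltnW.
  rewrite /L mulrAC ler_pdivlMr //.
  have : d1 / 2 * (u%:R - l%:R) <= hbar * (u%:R - l%:R) by rewrite ler_wpM2r // ltW.
  lra.
have [phi [phi_gt0 phiE]] := ground h.
apply: le_trans dl2 _.
have [m fm] : exists m, forall v : 'rV[R]_n.+1, v 0 (inord m) = 0 ->
    ((spectrum (Hqs a k0 h s))`_0 + d2) * \sum_i v 0 i ^+ 2 <= qform (Hqs a k0 h s) v.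
  have D1_le : d2 * D1 <= z by exact: mul_le_of_le_div.
  have D2_le : d2 * D2 <= kap / 2 by apply: mul_le_of_le_div => //; rewrite divr_gt0.
  have d2_kap : 16 * d2 <= kap by apply: le_trans d1_kap; rewrite ler_pM2l.
  have d2_kap0 : 2 * d2 <= kap0 by apply: le_trans d1_kap0; rewrite ler_pM2l.
  have d2_C3 : 3 * d2 <= C by rewrite -ler_pdivlMl // mulrC.
  exact: (barrier_dirichlet c0_gt0 c0a k00 s0 s_lt1 h_ge0 phi_gt0 phiE K1 l_gt0 lu un supp hbar0 h_le hbC uL).
exact: spectral_gap_ge (Hqs_sym _ _ _ _) n_gt0 fm.
Qed.
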